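(* Let $G=\varinjlim G_n$ be the direct limit of an increasing sequence $G_1\subseteq G_2\subseteq\cdots$ of connected finite dimensional Lie groups and let $\alpha\colon\mathbb R\to\mathrm{Aut}(G)$ define a continuous action such that each $G_n$ is $\alpha$-invariant; put $\alpha_n(t)=\alpha(t)|_{G_n}$, and suppose that the infinitesimal generators $D_n\in\mathrm{der}(\mathfrak g_n)$ of the induced one-parameter groups of $\mathrm{Aut}(\mathfrak g_n)$ are semisimple. Assume that each pair $(G_n,\alpha_n)$ has the unique extension property and that, for each $n$, the condition $C_{\alpha_n}\subseteq C_{\pi^0}$ is sufficient for the extendability of a unitary representation $(\pi^0,\mathcal H^0)$ of $G_n^0$ to a ground state representation of $(G_n,\alpha_n)$. Then every unitary representation $(\pi^0,\mathcal H^0)$ of $G^0=\varinjlim G_n^0$ satisfying $C_\alpha\subseteq C_{\pi^0}$ extends uniquely to a strict ground state representation of $(G,\alpha)$.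
   Context: Unitary representations are strongly continuous. $G=\bigcup_nG_n$ carries the direct limit topology and is a Lie group with Lie algebra $\mathfrak g=\bigcup_n\mathfrak g_n$ (Glöckner), where $\mathfrak g_n$ is the Lie algebra of $G_n$. $G^0=\mathrm{Fix}(\alpha)$, $G_n^0=G_n\cap G^0=\mathrm{Fix}(\alpha_n)$, and $G^0=\varinjlim G_n^0$. Ground states: for a topological group $G$ with continuous $\mathbb R$-action $\alpha$, a positive energy representation of $(G,\alpha)$ is a triple $(\pi,U,\mathcal H)$ with $(\pi,\mathcal H)$ a unitary representation of $G$ and $U_t=e^{itH}$ a strongly continuous unitary one-parameter group with $H=H^*\ge0$ and $U_t\pi(g)U_{-t}=\pi(\alpha_t(g))$. Its minimal energy space is $\mathcal H^0=\ker H$, carrying the representation $\pi^0(g)=\pi(g)|_{\mathcal H^0}$ of $G^0$. It is a ground state representation if $\pi(G)\mathcal H^0$ spans a dense subspace of $\mathcal H$ ($U$ is then determined by $\pi$), and strict if, moreover, every bounded operator on $\mathcal H^0$ commuting with $\pi^0(G^0)$ extends to a bounded operator on $\mathcal H$ commuting with $\pi(G)$. A unitary representation of $G^0$ extends to a ground state representation of $(G,\alpha)$ if it is unitarily equivalent to the representation of $G^0$ on the minimal energy space of a ground state representation; uniqueness is up to unitary equivalence. $(G,\alpha)$ has the unique extension property if for any two ground state representations $(\pi_j,\mathcal H_j)$, $j=1,2$, every unitary $G^0$-equivalence $\mathcal H_1^0\to\mathcal H_2^0$ extends to a unitary $G$-equivalence $\mathcal H_1\to\mathcal H_2$. Cones: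 let $D$ be the infinitesimal generator of $\mathrm{Lie}(\alpha_t)$ on $\mathfrak g$ (so $D|_{\mathfrak g_n}=D_n$), $\mathfrak g^0=\ker D$, and $p_0\colon\mathfrak g\to\mathfrak g^0$ the projection along $D(\mathfrak g)$ (semisimplicity of the $D_n$ gives $\mathfrak g_n=\ker D_n\oplus D_n(\mathfrak g_n)$). $C_\alpha=\overline{\mathrm{conv}}\{p_0([Dx,x]):x\in\mathfrak g\}\subseteq\mathfrak g^0$, and $C_{\alpha_n}=\overline{\mathrm{conv}}\{p_0([D_nx,x]):x\in\mathfrak g_n\}\subseteq\mathfrak g_n^0=\ker D_n$. For a unitary representation $\pi^0$ of $G^0$ (or $G_n^0$), $C_{\pi^0}$ is the set of all $x$ in $\mathfrak g^0$ (resp. $\mathfrak g^0_n$) with $-i\,\partial\pi^0(x)\ge0$, where $\partial\pi^0(x)$ is the skew-adjoint generator of $t\mapsto\pi^0(\exp tx)$. *)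

(* Defs.v *)
From HB Require Import structures.
From mathcomp Require Import all_boot all_order all_algebra.
From mathcomp Require Import all_classical all_reals all_analysis.
From mathcomp Require Import sesquilinear complex.

Set Implicit Arguments.
Unset Strict Implicit.
Unset Printing Implicit Defensive.

Import Order.TTheory GRing.Theory Num.Theory.
Import numFieldNormedType.Exports.

Local Open Scope classical_set_scope.
Local Open Scope complex_scope.
Local Open Scope ring_scope.

HB.mixin Record isTopologicalGroup G & Topological G & Group G := {
  mulg_continuous : continuous (fun p : G * G => (p.1 * p.2)%g);
  invg_continuous : continuous (fun x : G => (x^-1)%g)
}.

#[short(type="topologicalGroupType")]
HB.structure Definition TopologicalGroup :=
  {G of Topological G & Group G & isTopologicalGroup G}.

(* C^k in the sense of iterated continuous directional derivatives; it is only
   used for finite-dimensional V and open U, where it is the usual notion. *)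
Fixpoint class_C (R : realType) (V W : normedModType R) (k : nat)
    (U : set V) (f : V -> W) : Prop :=
  {in U, continuous f} /\
  if k is k'.+1 then
    forall v, (forall x, U x -> derivable f x v) /\ class_C k' U ('D_v f)
  else True.

Definition smooth_on (R : realType) (V W : normedModType R)
    (U : set V) (f : V -> W) : Prop := forall k, class_C k U f.

(* [chart_map] and [chart_inv] are total; they only matter on [chart_dom] and
   on its image. *)
Record chart (R : realType) (M : topologicalType) (d : nat) := Chart {
  chart_dom : set M;
  chart_map :> M -> 'rV[R]_d;
  chart_inv : 'rV[R]_d -> M;
  chart_dom_open : open chart_dom;
  chart_img_open : open (chart_map @` chart_dom);
  chartK : {in chart_dom, cancel chart_map chart_inv};
  chart_continuous : {in chart_dom, continuous chart_map};
  chart_inv_continuous : {in chart_map @` chart_dom, continuous chart_inv}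
}.

(* The charts [mchart x] form the atlas. *)
HB.mixin Record isManifold (R : realType) M & Topological M := {
  mdim : nat;
  mchart : M -> chart R M mdim;
  mchartP : forall x, chart_dom (mchart x) x;
  mchart_smooth : forall x y,
    smooth_on (mchart x @` (chart_dom (mchart x) `&` chart_dom (mchart y)))
              (mchart y \o chart_inv (mchart x));
  manifold_hausdorff : hausdorff_space M
}.

#[short(type="manifoldType")]
HB.structure Definition Manifold (R : realType) :=
  {M of isManifold R M & Topological M}.

Arguments mdim {R} s : rename.

Definition smooth_map (R : realType) (M N : manifoldType R) (f : M -> N) :=
  continuous f /\
  forall x y,
    smooth_on (mchart x @` (chart_dom (mchart x) `&`
                            f @^-1` chart_dom (mchart y)))
              (mchart y \o f \o chart_inv (mchart x)).

(* Smoothness of a map on a product manifold, in the product charts. *)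
Definition smooth_map2 (R : realType) (M M' N : manifoldType R)
    (f : M -> M' -> N) :=
  continuous (fun p : M * M' => f p.1 p.2) /\
  forall x x' y,
    smooth_on [set (mchart x p.1, mchart x' p.2) | p in
                [set p : M * M' | [/\ chart_dom (mchart x) p.1,
                   chart_dom (mchart x') p.2 &
                   chart_dom (mchart y) (f p.1 p.2)]]]
      (fun q : 'rV[R]_(mdim M) * 'rV[R]_(mdim M') =>
         mchart y (f (chart_inv (mchart x) q.1) (chart_inv (mchart x') q.2))).

HB.mixin Record isLieGroup (R : realType) G
    & Manifold R G & TopologicalGroup G := {
  mulg_smooth : smooth_map2 (fun x y : G => (x * y)%g : G);
  invg_smooth : smooth_map (fun x : G => (x^-1)%g : G)
}.

#[short(type="lieGroupType")]
HB.structure Definition LieGroup (R : realType) :=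
  {G of isLieGroup R G & Manifold R G & TopologicalGroup G}.

Definition group_hom (G H : groupType) (f : G -> H) : Prop :=
  forall x y, f (x * y)%g = (f x * f y)%g.

Section LieAlgebra.
Variable R : realType.

(* The Lie algebra T_1 G is 'rV[R]_(mdim G), through the chart at 1. *)

(* The tangent map at 1 of f, for f 1 = 1; for a morphism f of Lie groups
   this is Lie(f). *)
Definition lie_map (G H : lieGroupType R) (f : G -> H)
    (x : 'rV[R]_(mdim G)) : 'rV[R]_(mdim H) :=
  'D_x (mchart (1%g : H) \o f \o chart_inv (mchart (1%g : G)))
       (mchart (1%g : G) 1%g).

Definition Ad (G : lieGroupType R) (g : G) :
    'rV[R]_(mdim G) -> 'rV[R]_(mdim G) :=
  lie_map (fun h : G => (g * h * g^-1)%g : G).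

(* [x, y] = ad x y, where ad is the derivative of Ad at 1; the curve below has
   velocity x at 1. *)
Definition lie_bracket (G : lieGroupType R) (x y : 'rV[R]_(mdim G)) :
    'rV[R]_(mdim G) :=
  derive1 (fun s : R =>
    Ad (chart_inv (mchart (1%g : G)) (mchart (1%g : G) 1%g + s *: x)) y) 0.

Definition one_parameter_subgroup (G : lieGroupType R)
    (x : 'rV[R]_(mdim G)) (gamma : R -> G) : Prop :=
  [/\ continuous gamma,
      forall s t, gamma (s + t) = (gamma s * gamma t)%g
    & is_derive (0 : R) 1 (mchart (1%g : G) \o gamma) x].

(* The default value 1 is never used: one-parameter subgroups exist and are
   unique. *)
Definition lie_exp (G : lieGroupType R) (x : 'rV[R]_(mdim G)) : G :=
  xget 1%g [set g | exists2 gamma, one_parameter_subgroup x gamma &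
                                   g = gamma 1].

End LieAlgebra.

(* Matrices act on row vectors from the right. *)
Definition semisimple_mx (F : fieldType) (n : nat) (A : 'M[F]_n) : Prop :=
  forall V : 'M[F]_n, stablemx V A ->
    exists W : 'M[F]_n,
      [/\ stablemx W A, (V + W :=: 1%:M)%MS & (V :&: W :=: (0 : 'M[F]_n))%MS].

Section Actions.
Variables (R : realType) (G : topologicalGroupType).

Record automorphic_action (alpha : R -> G -> G) : Prop := {
  action_hom : forall t, group_hom (alpha t);
  action0 : forall g, alpha 0 g = g;
  actionD : forall s t g, alpha (s + t) g = alpha s (alpha t g);
  action_continuous : continuous (fun p : R * G => alpha p.1 p.2)
}.

Definition fix_action (alpha : R -> G -> G) : set G :=
  [set g | forall t, alpha t g = g].

End Actions.

HB.mixin Record isHilbert (R : realType) H & CompleteNormedModule R[i] H := {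
  hdot : {dot H for @Num.conj R[i]};
  hdot_norm : forall v : H, hdot v v = `|v| ^+ 2
}.

#[short(type="hilbertType")]
HB.structure Definition Hilbert (R : realType) :=
  {H of isHilbert R H & CompleteNormedModule R[i] H}.

Section Unitary.
Variable R : realType.

Definition linear_on (H K : hilbertType R) (E : set H) (T : H -> K) : Prop :=
  forall (a : R[i]) v w, E v -> E w -> T (a *: v + w) = a *: T v + T w.

(* T is a unitary operator from the closed subspace E onto the closed
   subspace F; its values outside E are irrelevant. *)
Definition unitary_on (H K : hilbertType R) (E : set H) (F : set K)
    (T : H -> K) : Prop :=
  [/\ linear_on E T,
      forall v w, E v -> E w -> hdot (T v) (T w) = hdot v w
    & T @` E = F].

Definition unitary (H K : hilbertType R) (T : H -> K) : Prop :=
  unitary_on setT setT T.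

(* Bounded operators on the closed subspace E. *)
Definition bounded_operator_on (H : hilbertType R) (E : set H)
    (B : H -> H) : Prop :=
  [/\ linear_on E B,
      forall v, E v -> E (B v)
    & exists M : R, forall v, E v -> `|B v| <= M%:C * `|v|].

Definition linear_span (H : hilbertType R) (A : set H) : set H :=
  [set v | exists n (c : 'I_n -> R[i]) (a : 'I_n -> H),
     (forall i, A (a i)) /\ v = \sum_(i < n) c i *: a i].

(* A strongly continuous unitary representation of the subgroup S of G, with
   the subspace topology; the values of pi outside S are irrelevant. *)
Record unitary_rep (G : topologicalGroupType) (S : set G) (H : hilbertType R)
    (pi : G -> H -> H) : Prop := {
  rep_unitary : forall g, S g -> unitary (pi g);
  rep_mul : forall g h v, S g -> S h -> pi (g * h)%g v = pi g (pi h v);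
  rep_continuous : forall v, {within S, continuous (fun g => pi g v)}
}.

Definition intertwines (G : topologicalGroupType) (S : set G)
    (H K : hilbertType R) (E : set H) (pi : G -> H -> H) (rho : G -> K -> K)
    (T : H -> K) : Prop :=
  forall g v, S g -> E v -> T (pi g v) = rho g (T v).

Record unitary_group (H : hilbertType R) (U : R -> H -> H) : Prop := {
  ugroup_unitary : forall t, unitary (U t);
  ugroupD : forall s t v, U (s + t) v = U s (U t v);
  ugroup_continuous : forall v, continuous (fun t => U t v)
}.

(* The graph of the self-adjoint operator A with U_t = e^{itA}, that is, of
   -i times the skew-adjoint infinitesimal generator of U (Stone):
   v is in the domain of A and A v = w. *)
Definition hamiltonian (H : hilbertType R) (U : R -> H -> H) (v w : H) :=
  (t^-1)%:C *: (U t v - v) @[t --> (0 : R)^'] --> 'i *: w.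

Definition nonneg_hamiltonian (H : hilbertType R) (U : R -> H -> H) : Prop :=
  forall v w, hamiltonian U v w -> 0 <= hdot w v.

Section GroundStates.
Variables (G : topologicalGroupType) (alpha : R -> G -> G).

Record positive_energy_rep (H : hilbertType R) (pi : G -> H -> H)
    (U : R -> H -> H) : Prop := {
  per_rep : unitary_rep setT pi;
  per_group : unitary_group U;
  per_nonneg : nonneg_hamiltonian U;
  per_covariant : forall t g v, U t (pi g (U (- t) v)) = pi (alpha t g) v
}.

Definition minimal_energy (H : hilbertType R) (U : R -> H -> H) : set H :=
  [set v | hamiltonian U v 0].

Definition ground_state_rep (H : hilbertType R) (pi : G -> H -> H)
    (U : R -> H -> H) : Prop :=
  positive_energy_rep pi U /\
  closure (linear_span
    [set w | exists g, exists2 v, minimal_energy U v & w = pi g v]) = setT.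

Definition strict_ground_state_rep (H : hilbertType R) (pi : G -> H -> H)
    (U : R -> H -> H) : Prop :=
  ground_state_rep pi U /\
  forall B : H -> H,
    bounded_operator_on (minimal_energy U) B ->
    intertwines (fix_action alpha) (minimal_energy U) pi pi B ->
    exists B' : H -> H,
      [/\ bounded_operator_on setT B', intertwines setT setT pi pi B'
        & forall v, minimal_energy U v -> B' v = B v].

(* pi0 is unitarily equivalent to the representation of Fix(alpha) on the
   minimal energy space of (pi, U). *)
Definition extended_by (K : hilbertType R) (pi0 : G -> K -> K)
    (H : hilbertType R) (pi : G -> H -> H) (U : R -> H -> H) : Prop :=
  exists T : K -> H, unitary_on setT (minimal_energy U) T /\
                     intertwines (fix_action alpha) setT pi0 pi T.

Definition extends_to_ground_state (K : hilbertType R) (pi0 : G -> K -> K) :=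
  exists (H : hilbertType R) (pi : G -> H -> H) (U : R -> H -> H),
    ground_state_rep pi U /\ extended_by pi0 pi U.

Definition extends_uniquely_to_strict_ground_state (K : hilbertType R)
    (pi0 : G -> K -> K) : Prop :=
  (exists (H : hilbertType R) (pi : G -> H -> H) (U : R -> H -> H),
     strict_ground_state_rep pi U /\ extended_by pi0 pi U) /\
  forall (H1 : hilbertType R) (pi1 : G -> H1 -> H1) (U1 : R -> H1 -> H1)
         (H2 : hilbertType R) (pi2 : G -> H2 -> H2) (U2 : R -> H2 -> H2),
    strict_ground_state_rep pi1 U1 -> extended_by pi0 pi1 U1 ->
    strict_ground_state_rep pi2 U2 -> extended_by pi0 pi2 U2 ->
    exists T : H1 -> H2, unitary T /\ intertwines setT setT pi1 pi2 T.

Definition unique_extension_property : Prop :=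
  forall (H1 : hilbertType R) (pi1 : G -> H1 -> H1) (U1 : R -> H1 -> H1)
         (H2 : hilbertType R) (pi2 : G -> H2 -> H2) (U2 : R -> H2 -> H2),
    ground_state_rep pi1 U1 -> ground_state_rep pi2 U2 ->
    forall T0 : H1 -> H2,
      unitary_on (minimal_energy U1) (minimal_energy U2) T0 ->
      intertwines (fix_action alpha) (minimal_energy U1) pi1 pi2 T0 ->
      exists T : H1 -> H2,
        [/\ unitary T, intertwines setT setT pi1 pi2 T
          & forall v, minimal_energy U1 v -> T v = T0 v].

End GroundStates.

(* L is the Lie algebra, with bracket br, exponential function ex and
   derivation D, of a finite-dimensional Lie group or of a direct limit. *)
Section Cones.
Variables (L : topologicalLmodType R) (D : L -> L).

(* The projection onto ker D along the image of D; it is well defined when L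
   is the direct sum of the two. *)
Definition proj_ker (x : L) : L :=
  xget 0 [set z | D z = 0 /\ exists y, x = z + D y].

Definition convex_hull (A : set L) : set L :=
  \bigcap_(B in [set B : set L | convex_set B /\ A `<=` B]) B.

Definition cone_action (br : L -> L -> L) : set L :=
  closure (convex_hull [set proj_ker (br (D x) x) | x in setT]).

Definition cone_rep (G : topologicalGroupType) (ex : L -> G)
    (H : hilbertType R) (pi0 : G -> H -> H) : set L :=
  [set x | D x = 0 /\ nonneg_hamiltonian (fun t => pi0 (ex (t *: x)))].

End Cones.

(* For a Lie group, with the derivation x |-> x *m D. *)
Definition lie_cone_action (G : lieGroupType R) (D : 'M[R]_(mdim G)) :
    set 'rV[R]_(mdim G) :=
  cone_action (L := 'rV[R]_(mdim G)) (fun x => x *m D) (@lie_bracket R G).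

Definition lie_cone_rep (G : lieGroupType R) (D : 'M[R]_(mdim G))
    (H : hilbertType R) (pi0 : G -> H -> H) : set 'rV[R]_(mdim G) :=
  cone_rep (L := 'rV[R]_(mdim G)) (fun x => x *m D) (@lie_exp R G) pi0.

End Unitary.

(* G is the union of the increasing sequence of the G_n, seen in G through j n,
   and carries the direct limit topology. *)
Record is_direct_limit (R : realType) (Gn : nat -> lieGroupType R)
    (iota : forall n, Gn n -> Gn n.+1)
    (G : topologicalGroupType) (j : forall n, Gn n -> G) : Prop := {
  dl_iota_hom : forall n, group_hom (iota n);
  dl_iota_inj : forall n, injective (iota n);
  dl_iota_smooth : forall n, smooth_map (iota n);
  dl_hom : forall n, group_hom (j n);
  dl_inj : forall n, injective (j n);
  dl_compat : forall n x, j n.+1 (iota n x) = j n x;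
  dl_surj : forall g, exists n x, g = j n x;
  dl_open : forall A : set G, open A <-> forall n, open (j n @^-1` A)
}.

(* L is the union of the Lie algebras of the G_n, with the direct limit
   topology, Lie bracket br and exponential function ex; k n is the
   inclusion of the n-th Lie algebra. *)
Record is_limit_lie_algebra (R : realType) (Gn : nat -> lieGroupType R)
    (iota : forall n, Gn n -> Gn n.+1)
    (G : topologicalGroupType) (j : forall n, Gn n -> G)
    (L : topologicalLmodType R)
    (k : forall n, 'rV[R]_(mdim (Gn n)) -> L)
    (br : L -> L -> L) (ex : L -> G) : Prop := {
  dla_linear : forall n, linear (k n);
  dla_inj : forall n, injective (k n);
  dla_compat : forall n x, k n.+1 (lie_map (iota n) x) = k n x;
  dla_surj : forall y, exists n x, y = k n x;
  dla_open : forall A : set L, open A <-> forall n, open (k n @^-1` A);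
  dla_bracket : forall n x y, br (k n x) (k n y) = k n (lie_bracket x y);
  dla_exp : forall n x, ex (k n x) = j n (lie_exp x)
}.

(* The linear map x |-> x *m D is the infinitesimal generator of the
   one-parameter group t |-> Lie(alpha t). *)
Definition is_generator (R : realType) (G : lieGroupType R)
    (alpha : R -> G -> G) (D : 'M[R]_(mdim G)) : Prop :=
  forall x, is_derive (0 : R) 1 (fun t => lie_map (alpha t) x) (x *m D).

(* Main.v *)
Require Import Defs.
From HB Require Import structures.
From mathcomp Require Import all_boot all_order all_algebra.
From mathcomp Require Import all_classical all_reals all_analysis.
From mathcomp Require Import sesquilinear complex.
From mathcomp Require Import ring lra.

(* Both parts rest on one remark: a ground state representation (pi, U) of a
   group with the unique extension property is determined, through the
   Kolmogorov decomposition, by the coefficients <pi(g)v, w> with v, w in the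
   minimal energy space, and these can be compared on the cyclic
   subrepresentation that they generate.

   Uniqueness: every g in G lies in some G_n, so the coefficients over G are
   those of the restrictions to the G_n, and G inherits the unique extension
   property.

   Existence: k_n maps C_{alpha_n} into C_alpha, so pi0 restricted to G_n^0
   extends to a ground state representation on some H_n. Comparing coefficients
   gives G_n-equivariant isometries H_n -> H_{n+1}, and the extension lives on
   the direct limit of the H_n, realised as the space of bounded sequences x_n
   in H_n with x_n the projection of x_{n+1}. Positivity of the generator and
   the minimal energy space can then be read off componentwise.

   Strictness: a bounded operator in the commutant of pi0 is a linear combination
   of four unitaries of this commutant, and each of them extends by the unique
   extension property. *)

Set Implicit Arguments.
Unset Strict Implicit.
Unset Printing Implicit Defensive.

Import Order.TTheory GRing.Theory Num.Theory.
Import numFieldNormedType.Exports.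

Local Open Scope classical_set_scope.
Local Open Scope complex_scope.
Local Open Scope ring_scope.

(** * Hilbert spaces *)

(** The representation of $G_{n+1}$ on $H_{n+1}$, restricted to $G_n$, keeps positive energy, but
    the $G_n$-orbit of its minimal energy space need not be total, so the unique extension property
    of $G_n$ does not apply to it directly. Passing to the cyclic subrepresentation repairs this and
    keeps the minimal energy space, because $U_t\pi(g)v=\pi(\alpha_t(g))v$ whenever $U$ fixes $v$.
    The price is surjectivity: the comparison map $H_n\to H_{n+1}$ is only an isometry, and a
    genuine limit of Hilbert spaces is needed. Bounded compatible sequences form a complete space
    outright, with no completion or quotient to construct, and their component maps are contractions
    that intertwine the one-parameter groups. Unitaries enter the proof of strictness since the
    unique extension property speaks of unitary equivalences only. The cones are compatible because
    semisimplicity splits each Lie algebra into kernel and image of its derivation, so that the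
    projections $p_0$ of all levels agree. *)

Section HilbertBasics.
Variables (R : realType) (H : hilbertType R).
Implicit Types (u v w : H) (a : R[i]).

Lemma dotDl u v w : hdot (u + v) w = hdot u w + hdot v w.
Proof. exact: linearDl. Qed.

Lemma dotDr u v w : hdot u (v + w) = hdot u v + hdot u w.
Proof. exact: linearDr. Qed.

Lemma dotZl a v w : hdot (a *: v) w = a * hdot v w.
Proof. exact: linearZl_LR. Qed.

Lemma dotZr a v w : hdot v (a *: w) = conjc a * hdot v w.
Proof. exact: linearZr_LR. Qed.

Lemma dotNl v w : hdot (- v) w = - hdot v w.
Proof. exact: linearNl. Qed.

Lemma dotBr u v w : hdot u (v - w) = hdot u v - hdot u w.
Proof. exact: linearBr. Qed.

Lemma dotC v w : hdot v w = conjc (hdot w v).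
Proof. by rewrite [LHS]hermC /= expr0 mul1r. Qed.

Lemma dot0l v : hdot 0 v = 0.
Proof. exact: linear0l. Qed.

Lemma dot0r v : hdot v 0 = 0.
Proof. exact: linear0r. Qed.

Lemma dot_suml (I : Type) (r : seq I) (F : I -> H) w :
  hdot (\sum_(i <- r) F i) w = \sum_(i <- r) hdot (F i) w.
Proof. exact: (big_morph (fun v => hdot v w) (fun u v => dotDl u v w) (dot0l w)). Qed.

Lemma dot_sumr (I : Type) (r : seq I) (F : I -> H) w :
  hdot w (\sum_(i <- r) F i) = \sum_(i <- r) hdot w (F i).
Proof. exact: (big_morph _ (dotDr w) (dot0r w)). Qed.

(** The norm of a Hilbert space over [R[i]] is an element of [R[i]]; its real part allows estimates
    in the ordered field [R]. *)
Definition nrm v : R := complex.Re `|v|.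

Definition rdot v w : R := complex.Re (hdot v w).

Lemma nrmE v : `|v| = (nrm v)%:C.
Proof. by rewrite /nrm RRe_real // normr_real. Qed.

Lemma nrm_ge0 v : 0 <= nrm v.
Proof. by rewrite -ler0c -nrmE normr_ge0. Qed.

Lemma nrm0 : nrm 0 = 0.
Proof. by rewrite /nrm normr0. Qed.

Lemma nrm0_eq0 v : nrm v = 0 -> v = 0.
Proof. by move=> v0; apply/eqP; rewrite -normr_eq0 nrmE v0. Qed.

Lemma nrmN v : nrm (- v) = nrm v.
Proof. by rewrite /nrm normrN. Qed.

Lemma nrmBC v w : nrm (v - w) = nrm (w - v).
Proof. by rewrite -opprB nrmN. Qed.

Lemma nrmD v w : nrm (v + w) <= nrm v + nrm w.
Proof. by rewrite -lecR rmorphD /= -!nrmE ler_normD. Qed.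

Lemma nrmB v w : nrm (v - w) <= nrm v + nrm w.
Proof. by rewrite -(nrmN w) nrmD. Qed.

Lemma nrm_tri u v w : nrm (u - w) <= nrm (u - v) + nrm (v - w).
Proof. by apply: le_trans (nrmD _ _); rewrite addrA subrK. Qed.

Lemma nrm_subr_le v w : nrm v <= nrm w + nrm (v - w).
Proof. by apply: le_trans (nrmD _ _); rewrite addrC subrK. Qed.

Lemma nrmZ a v : nrm (a *: v) = complex.Re `|a| * nrm v.
Proof.
by rewrite /nrm normrZ [`|v|]nrmE; case: `|a| => x y /=; rewrite mulr0 subr0.
Qed.

Lemma nrmZr (r : R) v : nrm (r%:C *: v) = `|r| * nrm v.
Proof. by rewrite nrmZ normc_def /= expr0n /= addr0 sqrtr_sqr. Qed.

Lemma dot_nrm v : hdot v v = (nrm v ^+ 2)%:C.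
Proof. by rewrite hdot_norm nrmE rmorphXn. Qed.

Lemma rdot_nrm v : rdot v v = nrm v ^+ 2.
Proof. by rewrite /rdot dot_nrm. Qed.

Lemma rdotC v w : rdot v w = rdot w v.
Proof. by rewrite /rdot dotC; case: (hdot w v). Qed.

Lemma rdotDl u v w : rdot (u + v) w = rdot u w + rdot v w.
Proof. by rewrite /rdot dotDl; case: (hdot u w); case: (hdot v w). Qed.

Lemma rdotDr u v w : rdot u (v + w) = rdot u v + rdot u w.
Proof. by rewrite rdotC rdotDl !(rdotC u). Qed.

Lemma rdotNl v w : rdot (- v) w = - rdot v w.
Proof. by rewrite /rdot dotNl; case: (hdot v w). Qed.

Lemma rdotNr v w : rdot v (- w) = - rdot v w.
Proof. by rewrite rdotC rdotNl rdotC. Qed.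

Lemma rdotZl (r : R) v w : rdot (r%:C *: v) w = r * rdot v w.
Proof. by rewrite /rdot dotZl; case: (hdot v w) => x y /=; rewrite mul0r subr0. Qed.

Lemma rdotZr (r : R) v w : rdot v (r%:C *: w) = r * rdot v w.
Proof. by rewrite rdotC rdotZl rdotC. Qed.

Lemma rdot_iN v w : rdot ('i%C *: v) w = - rdot v ('i%C *: w).
Proof. by rewrite /rdot dotZl dotZr; case: (hdot v w) => x y /=; ring. Qed.

(** The form is conjugate-linear in its second argument, so Re<v, iw> is the imaginary part of <v,
    w>. Thus [rdot] determines [hdot]; the same formula defines the inner product on the inverse
    limit. *)
Lemma dotE v w : hdot v w = (rdot v w +i* rdot v ('i%C *: w))%C.
Proof.
rewrite /rdot dotZr; case: (hdot v w) => x y /=.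
by apply/eqP; rewrite eq_complex /= eqxx /=; apply/eqP; ring.
Qed.

Lemma nrmD_sqr v w : nrm (v + w) ^+ 2 = nrm v ^+ 2 + nrm w ^+ 2 + 2 * rdot v w.
Proof. by rewrite -!rdot_nrm !rdotDl !rdotDr (rdotC w v); ring. Qed.

Lemma nrmB_sqr v w : nrm (v - w) ^+ 2 = nrm v ^+ 2 + nrm w ^+ 2 - 2 * rdot v w.
Proof. by rewrite nrmD_sqr nrmN rdotNr; ring. Qed.

Lemma parallelogram v w :
  nrm (v + w) ^+ 2 + nrm (v - w) ^+ 2 = 2 * nrm v ^+ 2 + 2 * nrm w ^+ 2.
Proof. by rewrite nrmD_sqr nrmB_sqr; ring. Qed.

(** Cauchy-Schwarz: the squared norm of |w| v - |v| w is 2 |v| |w| (|v| |w| - Re<v, w>). *)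
Lemma rdot_le v w : rdot v w <= nrm v * nrm w.
Proof.
have [w0|w0] := eqVneq (nrm w) 0.
  by rewrite (nrm0_eq0 w0) /rdot dot0r nrm0 mulr0.
have w1 : 0 < nrm w by rewrite lt_neqAle eq_sym w0 nrm_ge0.
have [v0|v0] := eqVneq (nrm v) 0.
  by rewrite (nrm0_eq0 v0) /rdot dot0l nrm0 mul0r.
have v1 : 0 < nrm v by rewrite lt_neqAle eq_sym v0 nrm_ge0.
have := sqr_ge0 (nrm ((nrm w)%:C *: v - (nrm v)%:C *: w)).
rewrite nrmB_sqr rdotZl (rdotC v) rdotZl (rdotC w) !nrmZr.
rewrite !(gtr0_norm, gtr0_norm v1) // => h.
have h' : 0 <= 2 * (nrm w * nrm v) * (nrm v * nrm w - rdot v w).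
  by apply: le_trans h _; rewrite le_eqVlt; apply/orP; left; apply/eqP; ring.
by move: h'; rewrite pmulr_rge0 ?subr_ge0 // !mulr_gt0.
Qed.

Lemma rdot_norm_le v w : `|rdot v w| <= nrm v * nrm w.
Proof.
rewrite ler_norml rdot_le andbT lerNl -rdotNl.
by apply: le_trans (rdot_le _ _) _; rewrite nrmN.
Qed.

Lemma nrmi v : nrm ('i%C *: v) = nrm v.
Proof.
rewrite nrmZ; suff -> : complex.Re `|('i%C : R[i])| = 1 by rewrite mul1r.
by rewrite normc_def /= expr0n add0r expr1n sqrtr1.
Qed.

Lemma dot_ext v w : (forall u, hdot u v = hdot u w) -> v = w.
Proof.
move=> vw; apply/eqP; rewrite -subr_eq0; apply/eqP/nrm0_eq0/eqP.
by rewrite -sqrf_eq0 -rdot_nrm /rdot dotBr vw subrr.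
Qed.

Lemma lt_complex_real (e : R[i]) : 0 < e -> exists2 d : R, 0 < d & e = d%:C.
Proof.
by case: e => d d'; rewrite ltcE /= => /andP[/eqP -> d0]; exists d.
Qed.

Lemma cvg_nrmP (T : Type) (F : set_system T) (FF : Filter F) (f : T -> H) v :
  f @ F --> v <-> forall e : R, 0 < e -> \forall x \near F, nrm (v - f x) < e.
Proof.
split=> [/cvgrPdist_lt h e e0|h].
  have := h e%:C; rewrite -[0]/(0%:C) ltcR => /(_ e0); apply: filterS => x.
  by rewrite nrmE ltcR.
apply/cvgrPdist_lt => _ /lt_complex_real[e e0 ->].
by apply: filterS (h e e0) => x; rewrite nrmE ltcR.
Qed.

Lemma continuous_nrmP (T : topologicalType) (f : T -> H) :
  continuous f <->
  forall x (e : R), 0 < e -> \forall y \near x, nrm (f x - f y) < e.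
Proof. by split=> h x; apply/cvg_nrmP; exact: h. Qed.

Lemma closure_nrmP (A : set H) v :
  closure A v <-> forall e : R, 0 < e -> exists2 a, A a & nrm (v - a) < e.
Proof.
split=> [Av e e0|h B /nbhs_ballP [_ /lt_complex_real[e e0 ->]] vB].
  have vB : nbhs v (ball v (e%:C : R[i])).
    by apply: nbhsx_ballx; rewrite -[0]/(0%:C) ltcR.
  have [a [Aa]] := Av _ vB.
  by rewrite -ball_normE /= nrmE ltcR; exists a.
have [a Aa va] := h _ e0; exists a; split=> //; apply: vB.
by rewrite -ball_normE /= nrmE ltcR.
Qed.

Lemma nrm_eps_eq v w : (forall e : R, 0 < e -> nrm (v - w) < e) -> v = w.
Proof.
move=> h; apply/eqP; rewrite -subr_eq0; apply/eqP/nrm0_eq0/le_anti.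
by rewrite nrm_ge0 andbT; apply/ler_addgt0Pl => e /h /ltW; rewrite addr0.
Qed.

Lemma nrm_complete (u : nat -> H) :
  (forall e : R, 0 < e -> exists N, forall m n, (N <= m)%N -> (N <= n)%N ->
     nrm (u m - u n) < e) ->
  exists l, forall e : R, 0 < e -> exists N, forall n, (N <= n)%N ->
     nrm (l - u n) < e.
Proof.
move=> uC; have : cvg (u @ \oo).
  apply: cauchy_cvg; apply/cauchy_exP => _ /lt_complex_real[e e0 ->].
  have [N uN] := uC e e0; exists (u N), N => // n /= Nn.
  by rewrite -ball_normE /= nrmE ltcR; apply: uN.
move=> /cvg_nrmP ul; exists (lim (u @ \oo)) => e e0.
by have [N _ uN] := ul e e0; exists N => n; apply: uN.
Qed.

End HilbertBasics.

Section LinearMaps.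
Variables (R : realType) (H K : hilbertType R) (A : H -> K).
Hypothesis Al : linear A.

Lemma lin0 : A 0 = 0.
Proof. by have := Al (-1) 0 0; rewrite scaleN1r oppr0 addr0 scaleN1r addNr. Qed.

Lemma linD v w : A (v + w) = A v + A w.
Proof. by have := Al 1 v w; rewrite !scale1r. Qed.

Lemma linZ (a : R[i]) v : A (a *: v) = a *: A v.
Proof. by have := Al a v 0; rewrite lin0 !addr0. Qed.

Lemma linN v : A (- v) = - A v.
Proof. by rewrite -scaleN1r linZ scaleN1r. Qed.

Lemma linB v w : A (v - w) = A v - A w.
Proof. by rewrite linD linN. Qed.

Lemma lin_sum (I : Type) (r : seq I) (P : pred I) (F : I -> H) :
  A (\sum_(i <- r | P i) F i) = \sum_(i <- r | P i) A (F i).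
Proof. exact: (big_morph A linD lin0). Qed.

End LinearMaps.

(** * Riesz representation, orthogonal projection and adjoints *)

Section Riesz.
Variables (R : realType) (H : hilbertType R).

Definition subspace (E : set H) :=
  E 0 /\ forall (a : R[i]) v w, E v -> E w -> E (a *: v + w).

Variable E : set H.
Hypotheses (Esub : subspace E) (Ecl : closure E `<=` E).

Lemma subspaceD v w : E v -> E w -> E (v + w).
Proof. by move=> Ev Ew; rewrite -[v]scale1r; apply: Esub.2. Qed.

Lemma subspaceZ a v : E v -> E (a *: v).
Proof. by move=> Ev; rewrite -[_ *: _]addr0; apply: Esub.2 => //; exact: Esub.1. Qed.

(** Variational proof: the representing vector minimises J(v) = |v|^2 - 2 Re f(v) on E. A minimising
    sequence is Cauchy by the parallelogram law, the first variation at its limit gives the real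
    parts, and replacing h by ih gives the imaginary parts. *)
Lemma riesz_subspace (f : H -> R[i]) (M : R) :
  (forall a v w, E v -> E w -> f (a *: v + w) = a * f v + f w) ->
  (forall v, E v -> `|complex.Re (f v)| <= M * nrm v) ->
  exists2 v, E v & forall h, E h -> f h = hdot h v.
Proof.
move=> fl fM; pose g v := complex.Re (f v).
have f0 : f 0 = 0.
  have := fl (-1) 0 0 Esub.1 Esub.1.
  by rewrite scaleN1r oppr0 addr0 mulN1r addNr.
have gD v w : E v -> E w -> g (v + w) = g v + g w.
  move=> Ev Ew; rewrite /g -[v in LHS]scale1r fl // mul1r.
  by case: (f v); case: (f w).
have gZ (r : R) v : E v -> g (r%:C *: v) = r * g v.
  move=> Ev; rewrite /g -[_ *: _]addr0 fl //; last exact: Esub.1.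
  by rewrite f0 addr0; case: (f v) => x y /=; rewrite mul0r subr0.
pose J v := nrm v ^+ 2 - 2 * g v.
have JM v : E v -> - (M ^+ 2) <= J v.
  move=> Ev; have /ler_normlP[_ h] := fM v Ev; rewrite -/(g v) in h.
  have := sqr_ge0 (nrm v - M); rewrite /J => h2; nra.
pose S := [set J v | v in E].
have Sinf : has_inf S.
  split; first by exists (J 0), 0 => //; exact: Esub.1.
  by exists (- M ^+ 2) => _ [v Ev <-]; exact: JM.
have dJ v : E v -> inf S <= J v.
  by move=> Ev; apply: ge_inf; [exact: Sinf.2 | exists v].
have /choice[u uP] (n : nat) : exists v, E v /\ J v < inf S + n.+1%:R^-1.
  have n0 : 0 < n.+1%:R^-1 :> R by rewrite invr_gt0.
  by have [_ [v Ev <-] vJ] := inf_adherent n0 Sinf; exists v.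
(* Parallelogram law, together with the bound of [J] from below at the midpoint of v and w. *)
have mid v w : E v -> E w ->
    nrm (v - w) ^+ 2 <= 2 * (J v - inf S) + 2 * (J w - inf S).
  move=> Ev Ew; have Evw := subspaceD Ev Ew.
  have := dJ _ (subspaceZ ((2^-1 : R)%:C) Evw).
  rewrite /J gZ // gD // nrmZr gtr0_norm ?invr_gt0 // exprMn.
  have := parallelogram v w; set x := nrm (v - w) ^+ 2.
  set y := nrm (v + w) ^+ 2; lra.
have inv_small (e : R) : 0 < e -> exists N : nat, forall n, (N <= n)%N -> n.+1%:R^-1 < e.
  move=> e0; have [N _ NP] := near_infty_natSinv_lt (PosNum e0).
  by exists N => n Nn; apply: NP.
have [v vl] : exists l, forall e : R, 0 < e -> exists N, forall n, (N <= n)%N ->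
     nrm (l - u n) < e.
  apply: nrm_complete => e e0.
  have [N NP] := inv_small (e ^+ 2 / 4) (divr_gt0 (exprn_gt0 2 e0) (ltr0n _ 4)).
  exists N => m n Nm Nn; rewrite -(ltr_pXn2r (ltn0Sn 1)) ?nnegrE ?nrm_ge0 ?ltW //.
  have [Em Jm] := uP m; have [En Jn] := uP n.
  have := mid _ _ Em En; have := NP _ Nm; have := NP _ Nn; move: Jm Jn.
  move: (_ ^-1) (_ ^-1) (J _) (J _) (inf S) (_ ^+ 2) (_ ^+ 2) => x y z t d a b.
  lra.
have Ev : E v.
  apply: Ecl; apply/closure_nrmP => e e0; have [N NP] := vl e e0.
  by exists (u N); [exact: (uP N).1 | exact: NP].
exists v => //.
have rE h : E h -> rdot h v = g h.
  move=> Eh; pose c := rdot h v - g h; pose a := nrm h.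
  have a0 : 0 <= a by exact: nrm_ge0.
  (* First variation up to e: [J] at [u n + t h] is at least [inf S], while [J (u n)] exceeds it by
     less than e / 2; replacing [u n] by v costs another e / 2. *)
  have key (t e : R) : 0 < e -> - e <= t ^+ 2 * a ^+ 2 + 2 * t * c.
    move=> e0; pose b := 4 * `|t| * a + 1.
    have b0 : 0 < b by rewrite /b ltr_wpDl // !mulr_ge0.
    have [N1 N1P] := inv_small (e / 2) (divr_gt0 e0 (ltr0n _ 2)).
    have [N2 N2P] := vl (e / b) (divr_gt0 e0 b0).
    pose n := maxn N1 N2; have [En Jn] := uP n.
    have := dJ _ (subspaceD En (subspaceZ (t%:C) Eh)).
    have := N1P n (leq_maxl _ _); have := N2P n (leq_maxr _ _).
    rewrite ltr_pdivlMr // => vn n1.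
    move: Jn; rewrite /J gD //; last exact: subspaceZ.
    rewrite gZ // nrmD_sqr nrmZr exprMn real_normK ?num_real // rdotC rdotZl => Jn1 Jn2.
    have dlt : `|t * rdot h (v - u n)| <= `|t| * (a * nrm (v - u n)).
      by rewrite normrM ler_wpM2l // rdot_norm_le.
    have : 4 * (`|t| * (a * nrm (v - u n))) <= e.
      apply: le_trans (ltW vn); rewrite /b; have := nrm_ge0 (v - u n).
      by set y := nrm _; nra.
    move: dlt; rewrite rdotDr rdotNr ler_norml => /andP[d1 d2] d3.
    rewrite /c -/a; move: Jn1 Jn2; rewrite -/a; move: d1 d2 d3.
    move: n1; move: (_ ^-1) (_ * (_ * nrm _)) => x y; lra.
  apply/eqP; rewrite -subr_eq0 -/c; apply/negP => /negP c0.
  (* The 1 avoids a division by zero. At t = - c / b the quadratic equals - c^2 / b - c^2 / b^2,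
     which is below - c^2 / (2 b) when c is nonzero. *)
  pose b := a ^+ 2 + 1; have b0 : 0 < b by rewrite ltr_wpDl // sqr_ge0.
  have c2 : 0 < c ^+ 2 by rewrite exprn_even_gt0.
  have := key (- c / b) (c ^+ 2 / b / 2).
  rewrite !divr_gt0 // => /(_ isT); apply/negP; rewrite -ltNge.
  have -> : (- c / b) ^+ 2 * a ^+ 2 + 2 * (- c / b) * c =
            - (c ^+ 2 / b) - (c ^+ 2 / b / b).
    by rewrite /b; field; rewrite gt_eqF.
  have p1 : 0 < c ^+ 2 / b by rewrite divr_gt0.
  have p2 : 0 < c ^+ 2 / b / b by rewrite divr_gt0.
  by move: p1 p2; set x := _ / b; set y := x / b; lra.
move=> h Eh; have r1 := rE h Eh; have r2 := rE _ (subspaceZ 'i%C Eh).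
move: r1 r2; rewrite /g /rdot dotZl -[_ *: _]addr0 fl //; last exact: Esub.1.
rewrite f0 addr0; case: (f h) => x y; case: (hdot h v) => x' y' /=.
by rewrite !mul0r !mul1r !sub0r => -> /oppr_inj ->.
Qed.

Lemma proj_subspace (x : H) :
  exists2 v, E v & forall h, E h -> hdot h x = hdot h v.
Proof.
apply: (riesz_subspace (M := nrm x)) => [a v w _ _|v _].
  by rewrite dotDl dotZl.
by rewrite mulrC; exact: rdot_norm_le.
Qed.

End Riesz.

Lemma adjoint_exists (R : realType) (H K : hilbertType R) (A : H -> K) (M : R) :
  linear A -> (forall v, nrm (A v) <= M * nrm v) ->
  exists B : K -> H, forall v w, hdot (A v) w = hdot v (B w).
Proof.
move=> Al AM; suff /choice[B BP] : forall w, exists v, forall h, hdot (A h) w = hdot h v.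
  by exists B => v w; exact: BP.
move=> w; have [||||v _ vP] := @riesz_subspace R H setT _ _
    (fun h => hdot (A h) w) (M * nrm w).
- by split.
- by [].
- by move=> a u v _ _; rewrite Al dotDl dotZl.
- move=> v _; apply: le_trans (rdot_norm_le _ _) _.
  by rewrite mulrAC ler_wpM2r ?nrm_ge0.
- by exists v => h; exact: vP.
Qed.

Section Adjoint.
Variables (R : realType) (H K : hilbertType R) (A : H -> K) (B : K -> H).
Hypothesis AB : forall v w, hdot (A v) w = hdot v (B w).

Lemma adjoint_linear : linear B.
Proof.
move=> a v w; apply: dot_ext => u.
by rewrite -AB !dotDr !dotZr !AB.
Qed.

Lemma adjoint_bound (M : R) : 0 <= M -> (forall v, nrm (A v) <= M * nrm v) ->
  forall w, nrm (B w) <= M * nrm w.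
Proof.
move=> M0 AM w; have [->|w0] := eqVneq (nrm (B w)) 0.
  by rewrite mulr_ge0 ?nrm_ge0.
have w1 : 0 < nrm (B w) by rewrite lt_neqAle eq_sym w0 nrm_ge0.
rewrite -(ler_pM2l w1) -expr2 -rdot_nrm /rdot -AB.
apply: le_trans (rdot_le _ _) _; rewrite mulrCA mulrA.
by rewrite ler_wpM2r ?nrm_ge0.
Qed.

End Adjoint.

(** * Inverse limits of Hilbert spaces *)

(** The maps go down and contract, so norms increase along a compatible sequence; the bound in
    [ilim] then makes them converge, and the limit serves as the norm. *)
Record tower (R : realType) := Tower {
  tw :> nat -> hilbertType R;
  twq : forall n, tw n.+1 -> tw n;
  tw_lin : forall n, linear (@twq n);
  tw_contr : forall n x, nrm (@twq n x) <= nrm x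
}.

Record ilim (R : realType) (T : tower R) := ILim {
  ilv :> forall n, T n;
  ilvq : forall n, twq (ilv n.+1) = ilv n;
  ilv_bnd : exists M : R, forall n, nrm (ilv n) <= M
}.

Section InverseLimit.
Variables (R : realType) (T : tower R).
Local Notation V := (ilim T).
Implicit Types x y z : V.

Lemma ilim_ext x y : (forall n, x n = y n) -> x = y.
Proof.
case: x y => [x xq xb] [y yq yb] /= xy.
have e : x = y by apply: functional_extensionality_dep.
by subst y; congr ILim; exact: Prop_irrelevance.
Qed.

Fact il_zero_bnd : exists M : R, forall n, nrm (0 : T n) <= M.
Proof. by exists 0 => n; rewrite nrm0. Qed.

Definition il_zero : V :=
  @ILim R T (fun n => 0) (fun n => lin0 (@tw_lin _ T n)) il_zero_bnd.

Fact il_addq x y n : twq (x n.+1 + y n.+1) = x n + y n.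
Proof. by rewrite (linD (@tw_lin _ T n)) !ilvq. Qed.

Fact il_add_bnd x y : exists M : R, forall n, nrm (x n + y n) <= M.
Proof.
have [M xM] := ilv_bnd x; have [N yN] := ilv_bnd y.
by exists (M + N) => n; apply: le_trans (nrmD _ _) _; rewrite lerD.
Qed.

Definition il_add x y : V := ILim (il_addq x y) (il_add_bnd x y).

Fact il_scaleq (a : R[i]) x n : twq (a *: x n.+1) = a *: x n.
Proof. by rewrite (linZ (@tw_lin _ T n)) ilvq. Qed.

Fact il_scale_bnd (a : R[i]) x : exists M : R, forall n, nrm (a *: x n) <= M.
Proof.
have [M xM] := ilv_bnd x; exists (complex.Re `|a| * M) => n.
by rewrite nrmZ ler_wpM2l // -ler0c RRe_real ?normr_real.
Qed.

Definition il_scale a x : V := ILim (il_scaleq a x) (il_scale_bnd a x).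

Fact il_oppq x n : twq (- x n.+1) = - x n.
Proof. by rewrite (linN (@tw_lin _ T n)) ilvq. Qed.

Fact il_opp_bnd x : exists M : R, forall n, nrm (- x n) <= M.
Proof. by have [M xM] := ilv_bnd x; exists M => n; rewrite nrmN. Qed.

Definition il_opp x : V := ILim (il_oppq x) (il_opp_bnd x).

HB.instance Definition _ := gen_eqMixin V.
HB.instance Definition _ := gen_choiceMixin V.

Lemma il_addA : associative il_add.
Proof. by move=> x y z; apply: ilim_ext => n /=; rewrite addrA. Qed.
Lemma il_addC : commutative il_add.
Proof. by move=> x y; apply: ilim_ext => n /=; rewrite addrC. Qed.
Lemma il_add0 : left_id il_zero il_add.
Proof. by move=> x; apply: ilim_ext => n /=; rewrite add0r. Qed.
Lemma il_addN : left_inverse il_zero il_opp il_add.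
Proof. by move=> x; apply: ilim_ext => n /=; rewrite addNr. Qed.

HB.instance Definition _ := GRing.isZmodule.Build V il_addA il_addC il_add0 il_addN.

Lemma il_scaleA a b x : il_scale a (il_scale b x) = il_scale (a * b) x.
Proof. by apply: ilim_ext => n /=; rewrite scalerA. Qed.
Lemma il_scale1 : left_id 1 il_scale.
Proof. by move=> x; apply: ilim_ext => n /=; rewrite scale1r. Qed.
Lemma il_scaleDr : right_distributive il_scale +%R.
Proof. by move=> a x y; apply: ilim_ext => n /=; rewrite scalerDr. Qed.
Lemma il_scaleDl x : {morph il_scale^~ x : a b / a + b}.
Proof. by move=> a b; apply: ilim_ext => n /=; rewrite scalerDl. Qed.

HB.instance Definition _ := GRing.Zmodule_isLmodule.Build R[i] V
  il_scaleA il_scale1 il_scaleDr il_scaleDl.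

Lemma ilvD x y n : (x + y) n = x n + y n. Proof. by []. Qed.
Lemma ilvZ a x n : (a *: x) n = a *: x n. Proof. by []. Qed.
Definition il_norm x : R := limn (fun n => nrm (x n)).

Lemma il_nondecr x : nondecreasing_seq (fun n => nrm (x n)).
Proof. by apply/nondecreasing_seqP => n; rewrite -(ilvq x) tw_contr. Qed.

Lemma il_is_cvg x : cvgn (fun n => nrm (x n)).
Proof.
apply: nondecreasing_is_cvgn; first exact: il_nondecr.
by have [M xM] := ilv_bnd x; exists M => _ [n _ <-].
Qed.

Lemma il_cvg x : (fun n => nrm (x n)) @ \oo --> il_norm x.
Proof. exact: il_is_cvg. Qed.

Lemma il_norm_ge x n : nrm (x n) <= il_norm x.
Proof. exact: (nondecreasing_cvgn_le (@il_nondecr x) (@il_is_cvg x)). Qed.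

Lemma il_norm_le x M : (forall n, nrm (x n) <= M) -> il_norm x <= M.
Proof. by move=> xM; apply: limr_le; [exact: il_is_cvg | exact: nearW]. Qed.

Lemma il_normD x y : (il_norm (x + y))%:C <= (il_norm x)%:C + (il_norm y)%:C :> R[i].
Proof.
rewrite -rmorphD /= lecR; apply: il_norm_le => n; rewrite ilvD.
by apply: le_trans (nrmD _ _) _; rewrite lerD ?il_norm_ge.
Qed.

Lemma il_normZ a x : (il_norm (a *: x))%:C = `|a| * (il_norm x)%:C :> R[i].
Proof.
rewrite -[`|a|]RRe_real ?normr_real //; set c := complex.Re _.
rewrite -rmorphM; congr (_ %:C).
apply: (@cvg_unique _ _ (nrm ((a *: x) n) @[n --> \oo])) => //.
  exact: il_cvg.
have -> : (fun n => nrm ((a *: x) n)) = (fun n => c * nrm (x n)).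
  by apply/funext => n; rewrite ilvZ nrmZ.
by apply: cvgM (cvg_cst _) _; exact: il_cvg.
Qed.

Lemma il_norm_eq0 x : (il_norm x)%:C = 0 :> R[i] -> x = 0.
Proof.
move=> /complexI x0; apply: ilim_ext => n; apply: nrm0_eq0; apply/le_anti.
by rewrite nrm_ge0 andbT -x0 il_norm_ge.
Qed.

HB.instance Definition _ := Lmodule_isNormed.Build R[i] V
  il_normD il_normZ il_norm_eq0.

Lemma il_normrE x : `|x| = (il_norm x)%:C :> R[i].
Proof. by []. Qed.

(** Components are dominated by the norm, so a Cauchy filter converges in each component. The Cauchy
    estimate is uniform in n, which makes the limits a bounded sequence and gives convergence in
    norm. *)
Lemma il_complete (F : set_system V) : ProperFilter F -> cauchy F -> cvg F.
Proof.
move=> PF /cauchy_ballP Fc.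
have Fc' (e : R) : 0 < e -> \forall x & y \near F, il_norm (x - y) < e.
  move=> e0; have := Fc e%:C; rewrite -[0]/(0%:C) ltcR => /(_ e0).
  apply: filterS => -[x y] /=.
  by rewrite -ball_normE /= il_normrE ltcR.
have Fn n : cvg ((fun x : V => x n) @ F).
  apply: cauchy_cvg; apply/cauchy_exP => _ /lt_complex_real[e e0 ->].
  have [z zP] : exists z, \forall x \near F, il_norm (z - x) < e.
    by near F => z; exists z; near: z; exact: nearP_dep (Fc' e e0).
  exists (z n); apply: filterS zP => x xy.
  by rewrite -ball_normE /= nrmE ltcR; apply: le_lt_trans (il_norm_ge (z - x) n) xy.
pose y n := lim ((fun x : V => x n) @ F).
have Fy n (e : R) : 0 < e -> \forall x \near F, nrm (y n - ilv x n) < e.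
  by move=> e0; have /cvg_nrmP := Fn n; apply.
have yq n : twq (y n.+1) = y n.
  apply: nrm_eps_eq => e e0; have e2 : 0 < e / 2 by rewrite divr_gt0.
  near F => x.
  have h1 : nrm (y n.+1 - x n.+1) < e / 2 by near: x; exact: Fy.
  have h2 : nrm (y n - x n) < e / 2 by near: x; exact: Fy.
  have -> : twq (y n.+1) - y n = twq (y n.+1 - x n.+1) - (y n - x n).
    by rewrite (linB (@tw_lin _ T n)) ilvq opprB addrA subrK.
  apply: le_lt_trans (nrmB _ _) _.
  have := @tw_contr _ T n (y n.+1 - x n.+1); lra.
(* The auxiliary z is chosen after n and d': close to [y n] in component n, and close to x in norm.
   So the bound e does not depend on n. *)
have yle (e : R) : 0 < e -> \forall x \near F, forall n, nrm (y n - ilv x n) <= e.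
  move=> e0; near F => d; near=> x => n.
  apply/ler_addgt0Pl => d' d0; near F => z.
  have h1 : nrm (y n - z n) < d' by near: z; exact: Fy.
  have h2 : il_norm (x - z) < e.
    by near: z; near: x; apply: nearP_dep; exact: Fc'.
  apply: le_trans (nrm_tri _ (z n) _) _; apply: lerD; first exact: ltW.
  by rewrite nrmBC; exact: le_trans (il_norm_ge (x - z) n) (ltW h2).
have yb : exists M : R, forall n, nrm (y n) <= M.
  near F => x; exists (il_norm x + 1) => n.
  apply: le_trans (nrm_subr_le _ (x n)) _; apply: lerD; first exact: il_norm_ge.
  by move: n; near: x; exact: yle.
pose yy : V := ILim yq yb; apply/cvg_ex; exists yy.
apply/cvgrPdist_le => _ /lt_complex_real[e e0 ->].
have := yle e e0; apply: filterS => x xe.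
by rewrite il_normrE lecR; exact: il_norm_le.
Unshelve. all: by end_near. Qed.

HB.instance Definition _ := Uniform_isComplete.Build V il_complete.

Definition il_rdot x y : R := limn (fun n => rdot (x n) (y n)).

(** Polarisation: the real inner product is a combination of squared norms of x + y and x - y, whose
    limits exist. *)
Lemma il_rdot_cvg x y : (fun n => rdot (x n) (y n)) @ \oo --> il_rdot x y.
Proof.
pose f n := (nrm ((x + y) n) * nrm ((x + y) n) - nrm ((x - y) n) * nrm ((x - y) n)) / 4.
have e : (fun n => rdot (x n) (y n)) = f.
  by apply/funext => n; rewrite /f -!expr2 nrmD_sqr nrmB_sqr; field.
rewrite /il_rdot e.
have : f @ \oo --> (il_norm (x + y) * il_norm (x + y) -
               il_norm (x - y) * il_norm (x - y)) / 4.
  apply: cvgM; last exact: cvg_cst.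
  by apply: cvgB; apply: cvgM; exact: il_cvg.
by move=> /cvgP.
Qed.

Lemma il_rdotE x y (f : nat -> R) (l : R) :
  (forall n, rdot (x n) (y n) = f n) -> f @ \oo --> l -> il_rdot x y = l.
Proof. by move=> /funext xy fl; rewrite /il_rdot xy; apply/cvg_lim. Qed.

Lemma il_rdotC x y : il_rdot x y = il_rdot y x.
Proof. by apply: (il_rdotE _ (@il_rdot_cvg y x)) => n; rewrite rdotC. Qed.

Lemma il_rdotDl x y z : il_rdot (x + y) z = il_rdot x z + il_rdot y z.
Proof.
apply: (il_rdotE _ (cvgD (@il_rdot_cvg x z) (@il_rdot_cvg y z))) => n.
by rewrite rdotDl.
Qed.

Lemma il_rdotZl (r : R) x y : il_rdot (r%:C *: x) y = r * il_rdot x y.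
Proof.
apply: (il_rdotE _ (cvgM (cvg_cst r) (@il_rdot_cvg x y))) => n.
by rewrite rdotZl.
Qed.

Lemma il_rdot_ii x y : il_rdot ('i%C *: x) ('i%C *: y) = il_rdot x y.
Proof.
apply: (il_rdotE _ (@il_rdot_cvg x y)) => n.
rewrite /rdot dotZl dotZr; case: (hdot _ _) => a b /=; ring.
Qed.

Lemma il_rdot_norm x : il_rdot x x = il_norm x ^+ 2.
Proof.
apply: (il_rdotE _ (cvgM (@il_cvg x) (@il_cvg x))) => n.
by rewrite rdot_nrm expr2.
Qed.

Lemma il_rdotiN x y : il_rdot ('i%C *: x) y = - il_rdot x ('i%C *: y).
Proof.
rewrite -il_rdot_ii scalerA -expr2 sqr_i.
have -> : -1 = (-1)%:C :> R[i] by rewrite rmorphN.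
by rewrite il_rdotZl mulN1r.
Qed.

Definition il_dot x y : R[i] := (il_rdot x y +i* il_rdot x ('i%C *: y))%C.

Lemma il_dot_herm x y : il_dot x y = (-1) ^+ false * Num.conj (il_dot y x).
Proof.
rewrite expr0 mul1r; apply/eqP; rewrite eq_complex /= il_rdotC eqxx /=.
by rewrite -il_rdotiN il_rdotC.
Qed.

Lemma il_dotDl x y z : il_dot (x + y) z = il_dot x z + il_dot y z.
Proof. by rewrite /il_dot !il_rdotDl. Qed.

Lemma il_dotZl a x y : il_dot (a *: x) y = a * il_dot x y.
Proof.
case: a => r s; rewrite [(_ +i* _)%C]complexE /= scalerDl il_dotDl mulrDl.
have rE (t : R) z : il_dot (t%:C *: z) y = t%:C * il_dot z y.
  rewrite /il_dot !il_rdotZl; apply/eqP.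
  by rewrite eq_complex /= !mul0r subr0 addr0 !eqxx.
have iE z : il_dot ('i%C *: z) y = 'i%C * il_dot z y.
  rewrite /il_dot il_rdotiN il_rdot_ii; apply/eqP.
  by rewrite eq_complex /= !mul0r !mul1r sub0r add0r !eqxx.
by rewrite rE -scalerA iE rE mulrA.
Qed.

Lemma il_dot_bilinear :
  bilinear_for (GRing.Scale.Law.clone _ _ *%R _)
    (GRing.Scale.Law.clone _ _ (@Num.conj R[i] \; *%R) _) il_dot.
Proof.
split=> [y|x] a y1 y2 /=; first by rewrite il_dotDl il_dotZl.
rewrite !(il_dot_herm x) !expr0 !mul1r il_dotDl il_dotZl.
by rewrite rmorphD rmorphM.
Qed.

HB.instance Definition _ := bilinear_isBilinear.Build R[i] V V R[i]
  _ _ il_dot il_dot_bilinear.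

HB.instance Definition _ :=
  isHermitianSesquilinear.Build R[i] V false (@Num.conj R[i]) il_dot il_dot_herm.

Lemma il_dot_norm x : il_dot x x = `|x| ^+ 2.
Proof.
rewrite /il_dot il_rdot_norm il_normrE -rmorphXn /=.
have -> : il_rdot x ('i%C *: x) = 0; last by [].
by have := il_rdotiN x x; rewrite il_rdotC; lra.
Qed.

Lemma il_dot_gt0 x : x != 0 -> 0 < il_dot x x.
Proof. by move=> x0; rewrite il_dot_norm exprn_gt0 ?normr_gt0. Qed.

HB.instance Definition _ := isDotProduct.Build R[i] V il_dot il_dot_gt0.

HB.instance Definition _ := isHilbert.Build R V il_dot_norm.

Lemma nrm_ilim x : nrm x = il_norm x.
Proof. by []. Qed.

End InverseLimit.

Lemma dep_choice (I : Type) (T : I -> Type) (P : forall i, T i -> Prop) :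
  (forall i, exists y, P i y) -> exists f : forall i, T i, forall i, P i (f i).
Proof.
by move=> h; exists (fun i => projT1 (cid (h i))) => i; exact: projT2 (cid (h i)).
Qed.

(** * Isometries, closed subspaces and direct limits of Hilbert spaces *)

Section Isometries.
Variables (R : realType) (H K : hilbertType R).

Definition isom (A : H -> K) :=
  linear A /\ forall v w, hdot (A v) (A w) = hdot v w.

Lemma isom_nrm A v : isom A -> nrm (A v) = nrm v.
Proof.
move=> [_ Ad]; apply/eqP; rewrite -(eqrXn2 (ltn0Sn 1)) ?nrm_ge0 //.
by rewrite -!rdot_nrm /rdot Ad.
Qed.

Lemma isom_dist A v w : isom A -> nrm (A v - A w) = nrm (v - w).
Proof. by move=> Ai; rewrite -(linB Ai.1) isom_nrm. Qed.

Lemma isom_inj A : isom A -> injective A.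
Proof.
move=> Ai v w vw; apply/eqP; rewrite -subr_eq0; apply/eqP/nrm0_eq0.
by rewrite -(isom_dist _ _ Ai) vw subrr nrm0.
Qed.

(** Polarisation gives the real parts; complex linearity and [dotE] give the imaginary ones. *)
Lemma nrm_isom A : linear A -> (forall v, nrm (A v) = nrm v) -> isom A.
Proof.
move=> Al An; split=> // v w.
have rE x y : rdot (A x) (A y) = rdot x y.
  have := nrmD_sqr (A x) (A y); rewrite -(linD Al) !An nrmD_sqr; lra.
by rewrite !dotE -(linZ Al) !rE.
Qed.

End Isometries.

Lemma isom_comp (R : realType) (H K L : hilbertType R) (A : H -> K) (B : K -> L) :
  isom A -> isom B -> isom (fun v => B (A v)).
Proof.
move=> [Al Ad] [Bl Bd]; split=> [a v w|v w]; first by rewrite Al Bl.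
by rewrite Bd Ad.
Qed.

(* E is the inverse limit of the constant tower H <- H <- ... whose maps are the
   orthogonal projection onto E. *)
Lemma closed_subspace_hilbert (R : realType) (H : hilbertType R) (E : set H) :
  subspace E -> closure E `<=` E ->
  exists (S : hilbertType R) (i : S -> H), isom i /\ range i = E.
Proof.
move=> Esub Ecl.
have /choice[P PP] : forall x, exists v, E v /\ forall h, E h -> hdot h x = hdot h v.
  by move=> x; have [v Ev vP] := proj_subspace Esub Ecl x; exists v.
have dot_extE v w : E v -> E w -> (forall h, E h -> hdot h v = hdot h w) -> v = w.
  move=> Ev Ew vw; apply/eqP; rewrite -subr_eq0; apply/eqP/nrm0_eq0/eqP.
  rewrite -sqrf_eq0 -rdot_nrm /rdot dotBr vw ?subrr //.
  by rewrite -scaleN1r addrC; apply: Esub.2.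
have Pl : linear P.
  move=> a v w; apply: dot_extE => [||h Eh]; first exact: (PP _).1.
    by apply: Esub.2; exact: (PP _).1.
  by rewrite -(PP _).2 // !dotDr !dotZr -!(PP _).2.
have Pid v : E v -> P v = v.
  by move=> Ev; apply: dot_extE => // [|h Eh]; [exact: (PP _).1 | rewrite -(PP _).2].
have Pn v : nrm (P v) <= nrm v.
  have [->|w0] := eqVneq (nrm (P v)) 0; first exact: nrm_ge0.
  have w1 : 0 < nrm (P v) by rewrite lt_neqAle eq_sym w0 nrm_ge0.
  rewrite -(ler_pM2l w1) -expr2 -rdot_nrm /rdot -(PP v).2; last exact: (PP v).1.
  exact: rdot_le.
pose T := @Tower R (fun _ => H) (fun _ => P) (fun _ => Pl) (fun _ => Pn).
(* Each component is the projection of the next one, hence lies in E, where [P] is the identity: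
   compatible sequences are constant. *)
have cst (x : ilim T) n : x n = x 0.
  have xP m : P (x m.+1) = x m := ilvq x m.
  have E0 m : E (x m) by rewrite -xP; exact: (PP _).1.
  by elim: n => // n <-; rewrite -[RHS]xP Pid.
exists (ilim T), (fun x : ilim T => x 0%N : H); split.
  apply: nrm_isom => [a v w//|x]; rewrite nrm_ilim; apply/esym/cvg_lim => //.
  by under eq_fun do rewrite cst; exact: cvg_cst.
apply/seteqP; split=> [_ [x _ <-]|v Ev].
  by rewrite -(ilvq x 0); exact: (PP _).1.
have bnd : exists M : R, forall n : nat, nrm v <= M by exists (nrm v).
by exists (@ILim R T (fun _ => v) (fun _ => Pid v Ev) bnd).
Qed.

(** Completes one component to a whole sequence. The family [H] is arbitrary because the induction
    on m replaces it by its shift. *)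
Lemma ladder_section (H : nat -> Type) (up : forall n, H n -> H n.+1)
    (dn : forall n, H n.+1 -> H n) m (v : H m) :
  exists x : forall n, H n, [/\ x m = v,
    forall n, (n < m)%N -> x n = dn n (x n.+1) &
    forall n, (m <= n)%N -> x n.+1 = up n (x n)].
Proof.
elim: m H up dn v => [|m IH] H up dn v.
  by exists (nat_rect H v up).
have [x [xm xd xu]] := IH _ (fun n => up n.+1) (fun n => dn n.+1) v.
exists (nat_rect H (dn 0 (x 0)) (fun n _ => x n)); split=> //.
  by move=> [|n] //= nm; apply: xd.
by move=> [|n] //= mn; apply: xu.
Qed.

(* The space is the inverse limit along the adjoints of the Phi n, and i n is the
   adjoint of the n-th component map p n. *)
Lemma hilbert_direct_limit (R : realType) (H : nat -> hilbertType R)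
    (Phi : forall n, H n -> H n.+1) : (forall n, isom (Phi n)) ->
  exists (Hi : hilbertType R) (i : forall n, H n -> Hi) (p : forall n, Hi -> H n),
  [/\ forall n, isom (i n),
      forall n v, i n.+1 (Phi n v) = i n v,
      forall n x v, hdot (p n x) v = hdot x (i n v)
    & forall x (e : R), 0 < e ->
        exists N, forall n, (N <= n)%N -> nrm (x - i n (p n x)) < e].
Proof.
move=> PhiI.
have PhiC n v : nrm (Phi n v) <= 1 * nrm v by rewrite mul1r isom_nrm.
have /dep_choice[q qP] : forall n, exists B : H n.+1 -> H n,
    forall v w, hdot (Phi n v) w = hdot v (B w).
  by move=> n; exact: adjoint_exists (PhiI n).1 (PhiC n).
have ql n : linear (q n) := adjoint_linear (qP n).
have qc n x : nrm (q n x) <= nrm x.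
  by have := adjoint_bound (qP n) ler01 (PhiC n) x; rewrite mul1r.
have qPhi n v : q n (Phi n v) = v.
  by apply: dot_ext => u; rewrite -qP (PhiI n).2.
pose T := Tower ql qc.
pose p n (x : ilim T) : H n := x n.
have pl n : linear (p n) by [].
have pn n x : nrm (p n x) <= 1 * nrm x by rewrite mul1r; exact: il_norm_ge.
have /dep_choice[i iP] : forall n, exists B : H n -> ilim T,
    forall x v, hdot (p n x) v = hdot x (B v).
  by move=> n; exact: adjoint_exists (pl n) (pn n).
have il n : linear (i n) := adjoint_linear (iP n).
have ic n v : nrm (i n v) <= nrm v.
  by have := adjoint_bound (iP n) ler01 (pn n) v; rewrite mul1r.
have sub_sqr n x v : nrm (x - i n v) ^+ 2 =
    nrm x ^+ 2 + nrm (i n v) ^+ 2 - 2 * rdot (p n x) v.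
  by rewrite nrmB_sqr /rdot iP.
(* A sequence X through v with |X| <= |v| gives |X - i v|^2 = |X|^2 + |i v|^2 - 2 |v|^2 <= 0. Hence
   [i m v] is X, and its component m is v. *)
have pi m (v : H m) : p m (i m v) = v.
  have [x [xm xd xu]] := ladder_section Phi q v.
  have xq n : q n (x n.+1) = x n.
    by have [mn|nm] := leqP m n; [rewrite xu // qPhi | rewrite -xd].
  have xn n : nrm (x n) <= nrm v.
    have nd : nondecreasing_seq (fun n => nrm (x n)).
      by apply/nondecreasing_seqP => k; rewrite -(xq k) qc.
    have xE d : nrm (x (m + d)%N) = nrm v.
      elim: d => [|d IH]; first by rewrite addn0 xm.
      by rewrite addnS xu ?leq_addr // isom_nrm.
    by rewrite -(xE n); apply: nd; rewrite leq_addl.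
  have xb : exists M : R, forall n, nrm (x n) <= M by exists (nrm v).
  pose X : ilim T := @ILim R T x xq xb.
  have Xn : nrm X <= nrm v by exact: il_norm_le.
  have pX : p m X = v by [].
  suff <- : X = i m v by [].
  apply/eqP; rewrite -subr_eq0; apply/eqP/nrm0_eq0/eqP.
  rewrite -sqrf_eq0; apply/eqP/le_anti/andP; split; last exact: sqr_ge0.
  rewrite sub_sqr pX rdot_nrm.
  have h1 : nrm X ^+ 2 <= nrm v ^+ 2 by rewrite ler_pXn2r ?nnegrE ?nrm_ge0.
  have h2 : nrm (i m v) ^+ 2 <= nrm v ^+ 2 by rewrite ler_pXn2r ?nnegrE ?nrm_ge0.
  lra.
have iI n : isom (i n) by split=> // v w; rewrite -iP pi.
exists (ilim T), i, p; split=> //.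
- move=> n v; apply: dot_ext => x; rewrite -!iP.
  have -> : p n x = q n (p n.+1 x) by rewrite -[p n x](ilvq x n).
  by rewrite [LHS]dotC qP -dotC.
- move=> x e e0; set a := nrm x; have a0 : 0 <= a by exact: nrm_ge0.
  (* The squared distance is a^2 - |x_n|^2 = (a - |x_n|)(a + |x_n|), at most 2a (a - |x_n|); hence
     this tolerance for the convergence of the norms. *)
  have b0 : 0 < e ^+ 2 / (2 * a + 1).
    by rewrite divr_gt0 ?exprn_gt0 // ltr_wpDl // mulr_ge0.
  have [N _ NP] := (cvgrPdist_lt _ _).1 (@il_cvg _ _ x) _ b0.
  exists N => n Nn; rewrite -(ltr_pXn2r (ltn0Sn 1)) ?nnegrE ?nrm_ge0 ?ltW //.
  rewrite sub_sqr (isom_nrm _ (iI n)) rdot_nrm -/a.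
  have := NP n Nn; rewrite /= -nrm_ilim -/a ger0_norm ?subr_ge0 ?il_norm_ge //.
  rewrite ltr_pdivlMr ?ltr_wpDl ?mulr_ge0 //; have := il_norm_ge x n.
  have := nrm_ge0 (x n); rewrite -[il_norm x]/a /p; nra.
Qed.

(** * Isometries determined by Gram matrices *)

Section Spans.
Variables (R : realType) (H : hilbertType R).
Implicit Types (X P : set H).

Lemma sub_span X : X `<=` linear_span X.
Proof.
move=> v Xv; exists 1%N, (fun _ => 1), (fun _ => v); split=> //.
by rewrite big_ord1 scale1r.
Qed.

Lemma span_sub X P : subspace P -> X `<=` P -> linear_span X `<=` P.
Proof.
move=> Psub XP _ [n [c [a [Xa ->]]]].
elim/big_ind: _ => [|v w|i _]; first exact: Psub.1.
  exact: subspaceD.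
by apply: subspaceZ => //; exact: XP.
Qed.

Lemma span_subspace X : subspace (linear_span X).
Proof.
split=> [|a _ _ [n [c [u [Xu ->]]]] [m [d [w [Xw ->]]]]].
  by exists 0%N, (fun _ => 0), (fun _ => 0); split=> [[]|] //; rewrite big_ord0.
pose cc k := match fintype.split k with inl i => a * c i | inr i => d i end.
pose uu k := match fintype.split k with inl i => u i | inr i => w i end.
exists (n + m)%N, cc, uu; split.
  by move=> k; rewrite /uu; case: fintype.split.
rewrite big_split_ord /= scaler_sumr; congr (_ + _); apply: eq_bigr => i _.
  by rewrite /cc /uu -[lshift m i]/(unsplit (inl i)) unsplitK scalerA.
by rewrite /cc /uu -[rshift n i]/(unsplit (inr i)) unsplitK.
Qed.

Lemma closure_subspace P : subspace P -> subspace (closure P).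
Proof.
move=> Psub; split=> [|a v w /closure_nrmP Pv /closure_nrmP Pw].
  by apply: subset_closure; exact: Psub.1.
apply/closure_nrmP => e e0; pose b := complex.Re `|a| + 1.
have a0 : 0 <= complex.Re `|a| by rewrite -ler0c RRe_real ?normr_real.
have b0 : 0 < b by rewrite ltr_wpDl.
have [v' Pv' vv] := Pv (e / 2 / b) (divr_gt0 (divr_gt0 e0 (ltr0n _ 2)) b0).
have [w' Pw' ww] := Pw (e / 2) (divr_gt0 e0 (ltr0n _ 2)).
exists (a *: v' + w'); first exact: Psub.2.
rewrite opprD addrACA -scalerBr; apply: le_lt_trans (nrmD _ _) _.
rewrite nrmZ; move: vv; rewrite ltr_pdivlMr // /b; have := nrm_ge0 (v - v').
by set x := nrm _; set y := nrm _ in ww *; nra.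
Qed.

Lemma closure_idem P : closure (closure P) `<=` closure P.
Proof. by rewrite -(closure_id _).1 //; exact: closed_closure. Qed.

Lemma closure_span_sub X P : subspace P -> closure P `<=` P -> X `<=` P ->
  closure (linear_span X) `<=` P.
Proof.
by move=> Psub Pcl XP; apply: subset_trans Pcl; apply: closureS; exact: span_sub.
Qed.

End Spans.

Section Agreement.
Variables (R : realType) (H K : hilbertType R).

Lemma eq_isom_subspace (A B : H -> K) : isom A -> isom B ->
  subspace [set v | A v = B v] /\ closure [set v | A v = B v] `<=` [set v | A v = B v].
Proof.
move=> Ai Bi; split; first split=> [|a v w /= vE wE] /=.
- by rewrite (lin0 Ai.1) (lin0 Bi.1).
- by rewrite Ai.1 Bi.1 vE wE.
move=> v /closure_nrmP vcl /=; apply: nrm_eps_eq => e e0.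
have [w /= wE vw] := vcl (e / 2) (divr_gt0 e0 (ltr0n _ 2)).
apply: le_lt_trans (nrm_tri _ (A w) _) _; rewrite (isom_dist _ _ Ai).
by rewrite wE (isom_dist _ _ Bi) (nrmBC w); lra.
Qed.

Lemma isom_eq_closure_span (A B : H -> K) (X : set H) : isom A -> isom B ->
  {in X, A =1 B} -> forall v, closure (linear_span X) v -> A v = B v.
Proof.
move=> Ai Bi AB; have [Esub Ecl] := eq_isom_subspace Ai Bi.
by apply: (closure_span_sub Esub Ecl) => v Xv; apply: AB; rewrite inE.
Qed.

Lemma isom_eq_total (A B : H -> K) (X : set H) : isom A -> isom B ->
  closure (linear_span X) = setT -> {in X, A =1 B} -> A =1 B.
Proof.
by move=> Ai Bi Xt AB v; apply: (isom_eq_closure_span Ai Bi AB); rewrite Xt.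
Qed.

(** Isometries are equicontinuous, so continuity of the orbit maps on a total set passes to the
    closed span. The intermediate vector w accounts for two of the three thirds of e. *)
Lemma isom_continuous_total (T : topologicalType) (A : T -> H -> K) (X : set H) :
  (forall s, isom (A s)) -> closure (linear_span X) = setT ->
  {in X, forall v, continuous (A^~ v)} -> forall v, continuous (A^~ v).
Proof.
move=> Ai Xt Ac v; pose P := [set v | continuous (A^~ v)].
suff : closure (linear_span X) `<=` P by rewrite Xt; apply.
apply: closure_span_sub => [|{}v /closure_nrmP vcl|{}v Xv]; last 1 first.
- by apply: Ac; rewrite inE.
- split=> [|a {}v w vc wc] s.
    rewrite (_ : A^~ 0 = cst 0); first exact: cvg_cst.
    by apply/funext => t; rewrite (lin0 (Ai t).1).
  rewrite (_ : A^~ _ = (fun t => a *: A t v + A t w)); last first.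
    by apply/funext => t; rewrite (Ai t).1.
  by apply: cvgD; [apply: cvgZ; [exact: cvg_cst | exact: vc] | exact: wc].
apply/continuous_nrmP => s e e0.
have e3 : 0 < e / 3 by rewrite divr_gt0.
have [w /= /continuous_nrmP wc vw] := vcl _ e3.
apply: filterS (wc s _ e3) => t st.
apply: le_lt_trans (nrm_tri _ (A s w) _) _.
have := nrm_tri (A s w) (A t w) (A t v).
rewrite !isom_dist // (nrmBC w); lra.
Qed.

End Agreement.

Section GramMatrix.
Variables (R : realType) (I : Type).

(** A formal linear combination is kept as a list, so that the same list can be evaluated in two
    Hilbert spaces without any linear independence. *)
Definition comb (H : hilbertType R) (a : I -> H) (s : seq (R[i] * I)) : H :=
  \sum_(p <- s) p.1 *: a p.2.

Lemma combP (H : hilbertType R) (a : I -> H) (c : R[i]) s s' :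
  comb a ([seq (c * p.1, p.2) | p <- s] ++ s') = c *: comb a s + comb a s'.
Proof.
rewrite /comb big_cat /= big_map scaler_sumr; congr (_ + _).
by apply: eq_bigr => p _; rewrite scalerA.
Qed.

Lemma comb1 (H : hilbertType R) (a : I -> H) i : comb a [:: (1, i)] = a i.
Proof. by rewrite /comb big_seq1 scale1r. Qed.

Lemma span_comb (H : hilbertType R) (a : I -> H) v :
  linear_span (range a) v -> exists s, v = comb a s.
Proof.
move=> [n [c [u [au ->]]]].
have /choice[f fP] : forall k, exists i, a i = u k.
  by move=> k; have [i _ <-] := au k; exists i.
exists [seq (c k, f k) | k <- enum 'I_n]; rewrite /comb big_map big_enum /=.
by apply: eq_bigr => k _; rewrite fP.
Qed.

Variables (H K : hilbertType R) (a : I -> H) (b : I -> K).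
Hypothesis ab : forall i i', hdot (a i) (a i') = hdot (b i) (b i').

Lemma comb_nrm s : nrm (comb a s) = nrm (comb b s).
Proof.
apply/eqP; rewrite -(eqrXn2 (ltn0Sn 1)) ?nrm_ge0 // -!rdot_nrm /rdot; apply/eqP.
congr (complex.Re _); rewrite /comb !dot_suml; apply: eq_bigr => p _.
rewrite !dot_sumr; apply: eq_bigr => q _.
by rewrite !dotZl !dotZr ab.
Qed.

Lemma comb_dist s s' : nrm (comb a s - comb a s') = nrm (comb b s - comb b s').
Proof.
have := comb_nrm ([seq (-1 * p.1, p.2) | p <- s'] ++ s).
by rewrite !combP !scaleN1r ![- _ + _]addrC.
Qed.

(** Uniqueness in the Kolmogorov decomposition. [Q] is the closure of the set of pairs ([comb a s],
    [comb b s]); equality of Gram matrices makes it the graph of an isometry, defined everywhere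
    because the vectors [a i] are total. *)
Lemma gram_isom : closure (linear_span (range a)) = setT ->
  exists T : H -> K, isom T /\ forall i, T (a i) = b i.
Proof.
move=> at_; pose Q x y := forall e : R, 0 < e ->
  exists2 s, nrm (x - comb a s) < e & nrm (y - comb b s) < e.
have Qex x : exists y, Q x y.
  have dense (e : R) : 0 < e -> exists s, nrm (x - comb a s) < e.
    move=> e0; have : closure (linear_span (range a)) x by rewrite at_.
    by move=> /closure_nrmP/(_ _ e0)[_ /span_comb[s ->] xs]; exists s.
  have /choice[s sP] (n : nat) : exists s, nrm (x - comb a s) < n.+1%:R^-1.
    by apply: dense; rewrite invr_gt0.
  have small (e : R) : 0 < e -> exists N : nat, forall n, (N <= n)%N ->
      nrm (x - comb a (s n)) < e.
    move=> e0; have [N _ NP] := near_infty_natSinv_lt (PosNum e0).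
    by exists N => n Nn; apply: lt_trans (sP n) (NP n Nn).
  have [y yl] : exists l, forall e : R, 0 < e -> exists N, forall n, (N <= n)%N ->
     nrm (l - comb b (s n)) < e.
    apply: nrm_complete => e e0.
    have [N NP] := small _ (divr_gt0 e0 (ltr0n _ 2)).
    exists N => m n Nm Nn; rewrite -comb_dist.
    apply: le_lt_trans (nrm_tri _ x _) _; rewrite nrmBC.
    by have := NP m Nm; have := NP n Nn; lra.
  exists y => e e0; have [N1 N1P] := small e e0; have [N2 N2P] := yl e e0.
  by exists (s (maxn N1 N2)); [apply: N1P; exact: leq_maxl | apply: N2P; exact: leq_maxr].
have Qlin (c : R[i]) x y x' y' : Q x y -> Q x' y' -> Q (c *: x + x') (c *: y + y').
  move=> xy xy' e e0; pose d := complex.Re `|c| + 1.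
  have c0 : 0 <= complex.Re `|c| by rewrite -ler0c RRe_real ?normr_real.
  have d0 : 0 < d by rewrite ltr_wpDl.
  have [s] := xy (e / 2 / d) (divr_gt0 (divr_gt0 e0 (ltr0n _ 2)) d0).
  rewrite !ltr_pdivlMr // => s1 s2.
  have [s' s1' s2'] := xy' (e / 2) (divr_gt0 e0 (ltr0n _ 2)).
  exists ([seq (c * p.1, p.2) | p <- s] ++ s');
    rewrite combP opprD addrACA -scalerBr; apply: le_lt_trans (nrmD _ _) _;
    rewrite nrmZ; move: s1 s2 s1' s2'; rewrite /d.
  - by have := nrm_ge0 (x - comb a s); nra.
  - by have := nrm_ge0 (y - comb b s); nra.
have Qnrm x y : Q x y -> nrm y = nrm x.
  move=> xy; apply/eqP; rewrite -subr_eq0 -normr_eq0; apply/eqP/le_anti.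
  rewrite normr_ge0 andbT; apply/ler_addgt0Pl => e e0; rewrite addr0.
  have [s] := xy _ (divr_gt0 e0 (ltr0n _ 2)).
  have := nrm_subr_le x (comb a s); have := nrm_subr_le (comb a s) x.
  have := nrm_subr_le y (comb b s); have := nrm_subr_le (comb b s) y.
  rewrite (comb_nrm s) ler_norml (nrmBC _ x) (nrmBC _ y).
  move: (nrm x) (nrm y) (nrm (x - _)) (nrm (y - _)) (nrm _) => *.
  by apply/andP; split; lra.
have Quniq x y y' : Q x y -> Q x y' -> y = y'.
  move=> xy xy'; apply/eqP; rewrite -subr_eq0; apply/eqP/nrm0_eq0.
  have := Qnrm _ _ (Qlin (-1) _ _ _ _ xy' xy).
  by rewrite !scaleN1r addNr nrm0 addrC.
have [T TP] := choice Qex.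
exists T; split.
  apply: nrm_isom => [c v w|v]; last exact: Qnrm.
  by apply: Quniq (TP _) _; exact: Qlin.
move=> i; apply: Quniq (TP _) _ => e e0.
by exists [:: (1, i)]; rewrite comb1 subrr nrm0.
Qed.

End GramMatrix.

Lemma unitaryP (R : realType) (H K : hilbertType R) (T : H -> K) :
  unitary T <-> isom T /\ forall w, exists v, T v = w.
Proof.
split=> [[Tl Td Ts]|[[Tl Td] Ts]].
  split=> [|w]; last by have [v _ <-] : range T w by [rewrite Ts]; exists v.
  by split=> [a v w|v w]; [apply: Tl | apply: Td].
split=> [a v w _ _|v w _ _|]; [exact: Tl | exact: Td |].
by apply/seteqP; split=> // w _; have [v <-] := Ts w; exists v.
Qed.

(** Surjectivity: the isometry S obtained in the other direction satisfies T S = id on the total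
    family b, hence everywhere. *)
Lemma gram_unitary (R : realType) (I : Type) (H K : hilbertType R)
    (a : I -> H) (b : I -> K) :
  (forall i i', hdot (a i) (a i') = hdot (b i) (b i')) ->
  closure (linear_span (range a)) = setT -> closure (linear_span (range b)) = setT ->
  exists T : H -> K, unitary T /\ forall i, T (a i) = b i.
Proof.
move=> ab ta tb; have [T [Ti TE]] := gram_isom ab ta.
have [S [Si SE]] := gram_isom (fun i i' => esym (ab i i')) tb.
exists T; split=> //; apply/unitaryP; split=> // w; exists (S w).
apply: (isom_eq_total (isom_comp Si Ti) _ tb) => [|_ /set_mem[i _ <-]].
  by split.
by rewrite SE TE.
Qed.

(** * Unitary groups and representations *)

Lemma preim_subspace (R : realType) (H K : hilbertType R) (A : H -> K) (P : set K) :
  isom A -> subspace P -> closure P `<=` P ->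
  subspace (A @^-1` P) /\ closure (A @^-1` P) `<=` A @^-1` P.
Proof.
move=> Ai Psub Pcl; split; first split=> [|a v w /= Pv Pw] /=.
- by rewrite (lin0 Ai.1); exact: Psub.1.
- by rewrite Ai.1; exact: Psub.2.
move=> v /closure_nrmP vcl; apply: Pcl; apply/closure_nrmP => e e0.
by have [w Pw vw] := vcl e e0; exists (A w); rewrite // isom_dist.
Qed.

(** An intertwining contraction carries difference quotients to difference quotients. Contractions
    rather than isometries are allowed in order to cover the component maps of the limit space. *)
Lemma hamiltonian_map (R : realType) (H K : hilbertType R) (U : R -> H -> H)
    (V : R -> K -> K) (A : H -> K) v w :
  linear A -> (forall v, nrm (A v) <= nrm v) -> (forall t v, A (U t v) = V t (A v)) ->
  hamiltonian U v w -> hamiltonian V (A v) (A w).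
Proof.
move=> Al An AU /cvg_nrmP Uvw; apply/cvg_nrmP => e /Uvw; apply: filterS => t.
rewrite -AU -(linB Al) -!(linZ Al) -(linB Al); apply: le_lt_trans; exact: An.
Qed.

Lemma isom_id (R : realType) (H : hilbertType R) : isom (fun v : H => v).
Proof. by []. Qed.

Section UnitaryGroups.
Variables (R : realType) (H : hilbertType R) (U : R -> H -> H).
Hypothesis Ug : unitary_group U.

Lemma ugroup_isom t : isom (U t).
Proof. by have /unitaryP[] := ugroup_unitary Ug t. Qed.

Lemma ugroup0 v : U 0 v = v.
Proof. by apply: (isom_inj (ugroup_isom 0)); rewrite -(ugroupD Ug) addr0. Qed.

Lemma ugroupNK t v : U (- t) (U t v) = v.
Proof. by rewrite -(ugroupD Ug) addNr ugroup0. Qed.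

(* A vector at which the generator vanishes is fixed: subdividing [0, t] into n
   steps bounds |U_t v - v| by |t| times a difference quotient at t/n. *)
Lemma minimal_energyP v : minimal_energy U v <-> forall t, U t v = v.
Proof.
rewrite /minimal_energy /=; split=> [|vfix]; last first.
  rewrite /hamiltonian scaler0; under eq_fun do rewrite vfix subrr scaler0.
  exact: cvg_cst.
move=> /cvg_nrmP vU t; apply: nrm_eps_eq => e e0.
have [->|t0] := eqVneq t 0; first by rewrite ugroup0 subrr nrm0.
have nt0 : 0 < `|t| by rewrite normr_gt0.
have steps s n : nrm (U (s *+ n) v - v) <= n%:R * nrm (U s v - v).
  elim: n => [|n IH]; first by rewrite mulr0n ugroup0 subrr nrm0 mul0r.
  rewrite mulrSr (ugroupD Ug) -natr1 mulrDl mul1r.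
  apply: le_trans (nrm_tri _ (U (s *+ n) v) _) _.
  by rewrite (isom_dist _ _ (ugroup_isom _)) addrC lerD2r.
have := vU _ (divr_gt0 e0 nt0).
rewrite near_withinE => /nbhs_ballP[d /= d0 dP].
(* The number of steps: [s = t / n.+1] lands in the punctured ball of radius d, where the difference
   quotient is below e / |t|. *)
have [n _ nP] := near_infty_natSinv_lt (PosNum (divr_gt0 d0 nt0)).
pose s := t / n.+1%:R.
have s0 : s != 0 by rewrite mulf_neq0 // invr_neq0.
have n1 : n.+1%:R != 0 :> R by rewrite pnatr_eq0.
have ts : t = s *+ n.+1 by rewrite /s -mulr_natr mulfVK.
have sd : `|s| < d.
  have := nP n (leqnn n); rewrite /= ltr_pdivlMr // mulrC.
  by rewrite /s normrM normfV (ger0_norm (ler0n _ _)).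
have := dP s; rewrite -ball_normE /= sub0r normrN => /(_ sd s0).
rewrite scaler0 sub0r nrmN nrmZr normfV => h.
rewrite ts; apply: le_lt_trans (steps _ _) _.
have ns0 : 0 < `|s| by rewrite normr_gt0.
move: h; rewrite mulrC ltr_pdivrMr // => h.
rewrite -ltr_pdivlMl ?ltr0n //; apply: lt_le_trans h _.
rewrite /s normrM normfV (ger0_norm (ler0n _ _)) mulrA divfK ?gt_eqF //.
by rewrite mulrC.
Qed.

Lemma minimal_energy_subspace :
  subspace (minimal_energy U) /\ closure (minimal_energy U) `<=` minimal_energy U.
Proof.
have E t := eq_isom_subspace (ugroup_isom t) (isom_id H).
split; first split=> [|a v w /minimal_energyP Uv /minimal_energyP Uw].
- by apply/minimal_energyP => t; exact: (E t).1.1.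
- by apply/minimal_energyP => t; apply: (E t).1.2; [exact: Uv | exact: Uw].
move=> v vcl; apply/minimal_energyP => t; apply: (E t).2.
by apply: closureS vcl => w /minimal_energyP; apply.
Qed.

End UnitaryGroups.

Lemma group_hom1 (A B : groupType) (f : A -> B) : group_hom f -> f 1%g = 1%g.
Proof.
move=> fh; have := fh 1%g 1%g; rewrite mulg1 => /(congr1 (fun z => (f 1%g)^-1 * z)%g).
by rewrite mulgA mulVg mul1g.
Qed.

Section UnitaryReps.
Variables (R : realType) (G : topologicalGroupType) (H : hilbertType R).
Variable pi : G -> H -> H.
Hypothesis piU : unitary_rep setT pi.

Lemma rep_isom g : isom (pi g).
Proof. by have /unitaryP[] := rep_unitary piU (g := g) I. Qed.

Lemma repM g h v : pi (g * h)%g v = pi g (pi h v).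
Proof. exact: (rep_mul piU). Qed.

Lemma rep1 v : pi 1%g v = v.
Proof. by apply: (isom_inj (rep_isom 1%g)); rewrite -repM mulg1. Qed.

Lemma repKV g v : pi g (pi g^-1%g v) = v.
Proof. by rewrite -repM mulgV rep1. Qed.

(** This is why coefficients suffice: the Gram matrix of the orbit vectors consists of coefficients
    only. *)
Lemma rep_dot_gram g h v w : hdot (pi g v) (pi h w) = hdot (pi (h^-1 * g)%g v) w.
Proof. by rewrite -[RHS](rep_isom h).2 repM repKV. Qed.

Lemma rep_cont v : continuous (fun g => pi g v).
Proof. exact/continuous_subspace_setT/(rep_continuous piU). Qed.

End UnitaryReps.

Lemma unitary_repP (R : realType) (G : topologicalGroupType) (H : hilbertType R)
    (pi : G -> H -> H) :
  (forall g, isom (pi g)) -> (forall v, pi 1%g v = v) ->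
  (forall g h v, pi (g * h)%g v = pi g (pi h v)) ->
  (forall v, continuous (fun g => pi g v)) -> unitary_rep setT pi.
Proof.
move=> pii pi1 piM pic; split=> [g _|g h v _ _|v]; last 2 first.
- exact: piM.
- by apply: continuous_subspaceT; exact: pic.
by apply/unitaryP; split=> // w; exists (pi g^-1%g w); rewrite -piM mulgV pi1.
Qed.

(** The group [U], and with it the minimal energy space, does not change. Only positive energy is
    claimed, since totality of the orbit may be lost under restriction. *)
Lemma restrict_positive_energy (R : realType) (G G' : topologicalGroupType)
    (alpha : R -> G -> G) (beta : R -> G' -> G') (f : G' -> G)
    (H : hilbertType R) (pi : G -> H -> H) (U : R -> H -> H) :
  group_hom f -> continuous f -> (forall t x, f (beta t x) = alpha t (f x)) ->
  positive_energy_rep alpha pi U ->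
  positive_energy_rep beta (fun x => pi (f x)) U.
Proof.
move=> fh fc fa [piU Ug Upos Ucov]; split=> // [|t x v]; last by rewrite Ucov fa.
apply: unitary_repP => [x|v|x y v|v].
- exact: rep_isom.
- by rewrite (group_hom1 fh) rep1.
- by rewrite fh repM.
- move=> x; apply: (@continuous_comp _ _ _ f (fun g => pi g v)); first exact: fc.
  exact: rep_cont.
Qed.

Lemma unitary_groupP (R : realType) (H : hilbertType R) (U : R -> H -> H) :
  (forall t, isom (U t)) -> (forall v, U 0 v = v) ->
  (forall s t v, U (s + t) v = U s (U t v)) ->
  (forall v, continuous (fun t => U t v)) -> unitary_group U.
Proof.
move=> Ui U0 UD Uc; split=> // t.
by apply/unitaryP; split=> // w; exists (U (- t) w); rewrite -UD subrr U0.
Qed.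

(** * Ground state representations *)

Section CyclicSubrepresentation.
Variables (R : realType) (G : topologicalGroupType) (alpha : R -> G -> G).

Definition orbit_vectors (H : hilbertType R) (pi : G -> H -> H) (E : set H) : set H :=
  [set w | exists g, exists2 v, E v & w = pi g v].

Lemma minimal_energy_fix (H : hilbertType R) (pi : G -> H -> H) (U : R -> H -> H) g v :
  positive_energy_rep alpha pi U -> fix_action alpha g ->
  minimal_energy U v -> minimal_energy U (pi g v).
Proof.
move=> P gf /(minimal_energyP (per_group P)) h.
apply/(minimal_energyP (per_group P)) => t.
by rewrite -[v in LHS](h (- t)) (per_covariant P) gf.
Qed.

(** The closed span of the orbit of the minimal energy space is invariant under [U] as well, since
    U_t pi(h) w = pi(alpha_t(h)) w when [U] fixes w. It contains the minimal energy space (take h =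
    1), so nothing of the latter is lost. *)
Lemma cyclic_subrep (H : hilbertType R) (pi : G -> H -> H) (U : R -> H -> H) :
  positive_energy_rep alpha pi U ->
  exists (S : hilbertType R) (i : S -> H) (sigma : G -> S -> S) (V : R -> S -> S),
  [/\ isom i, ground_state_rep alpha sigma V,
      forall g s, i (sigma g s) = pi g (i s),
      forall s, minimal_energy V s <-> minimal_energy U (i s)
    & forall v, minimal_energy U v -> exists s, v = i s].
Proof.
move=> [piU Ug Upos Ucov]; pose X := orbit_vectors pi (minimal_energy U).
pose E := closure (linear_span X).
have Esub : subspace E by apply: closure_subspace; exact: span_subspace.
have Ecl : closure E `<=` E by exact: closure_idem.
have XE : X `<=` E by move=> v Xv; apply: subset_closure; exact: sub_span.
have invE (A : H -> H) : isom A -> (forall v, X v -> X (A v)) -> forall v, E v -> E (A v).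
  move=> Ai AX; have [Psub Pcl] := preim_subspace Ai Esub Ecl.
  by apply: (closure_span_sub Psub Pcl) => v Xv; apply: XE; exact: AX.
have piE g v : E v -> E (pi g v).
  apply: invE => [|_ [h [w Uw ->]]]; first exact: rep_isom.
  by exists (g * h)%g, w; rewrite ?repM.
have UE t v : E v -> E (U t v).
  apply: invE => [|_ [h [w Uw ->]]]; first exact: ugroup_isom.
  exists (alpha t h), w; rewrite // -Ucov.
  by have /(minimal_energyP Ug) -> := Uw.
have [S [i [ii iE]]] := closed_subspace_hilbert Esub Ecl.
have iP s : E (i s) by rewrite -iE; exists s.
have iS v : E v -> exists s, i s = v by rewrite -iE => -[s _ <-]; exists s.
have /choice[sig sigP] : forall g, exists f, forall s, i (f s) = pi g (i s).
  by move=> g; suff /choice[f fP] : forall s, exists s', i s' = pi g (i s);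
    [exists f | move=> s; apply: iS; exact: piE].
have /choice[V VP] : forall t, exists f, forall s, i (f s) = U t (i s).
  by move=> t; suff /choice[f fP] : forall s, exists s', i s' = U t (i s);
    [exists f | move=> s; apply: iS; exact: UE].
have iinj := isom_inj ii.
have lift_isom (A : H -> H) (B : S -> S) :
    isom A -> (forall s, i (B s) = A (i s)) -> isom B.
  move=> Ai BA; split=> [a v w|v w]; last by rewrite -ii.2 !BA Ai.2 ii.2.
  by apply: iinj; rewrite BA !ii.1 Ai.1 !BA.
have lift_cont (T : topologicalType) (A : T -> H -> H) (B : T -> S -> S) s :
    (forall t s, i (B t s) = A t (i s)) -> continuous (fun t => A t (i s)) ->
    continuous (fun t => B t s).
  move=> BA /continuous_nrmP Ac; apply/continuous_nrmP => t e e0.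
  by apply: filterS (Ac t e e0) => t'; rewrite -!BA isom_dist.
have sigU : unitary_rep setT sig.
  apply: unitary_repP => [g|s|g h s|s].
  - by apply: lift_isom (sigP g); exact: rep_isom.
  - by apply: iinj; rewrite sigP rep1.
  - by apply: iinj; rewrite !sigP repM.
  - by apply: lift_cont sigP _; exact: rep_cont.
have VU : unitary_group V.
  apply: unitary_groupP => [t|s|t t' s|s].
  - by apply: lift_isom (VP t); exact: ugroup_isom.
  - by apply: iinj; rewrite VP ugroup0.
  - by apply: iinj; rewrite !VP (ugroupD Ug).
  - by apply: lift_cont VP _; exact: ugroup_continuous.
have Vmin s : minimal_energy V s <-> minimal_energy U (i s).
  split=> [/(minimal_energyP VU) h|/(minimal_energyP Ug) h].
    by apply/(minimal_energyP Ug) => t; rewrite -VP h.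
  by apply/(minimal_energyP VU) => t; apply: iinj; rewrite VP h.
have minE v : minimal_energy U v -> E v.
  by move=> Uv; apply: XE; exists 1%g, v; rewrite ?rep1.
exists S, i, sig, V; split=> //; last first.
  by move=> v /minE/iS[s <-]; exists s.
split; first split=> // [v w vw|t g s].
- rewrite -ii.2; apply: Upos; apply: hamiltonian_map vw => // [|s].
    exact: ii.1.
  by rewrite isom_nrm.
- by apply: iinj; rewrite VP !sigP VP Ucov.
apply/seteqP; split=> // s _; apply/closure_nrmP => e e0.
have /closure_nrmP/(_ e e0)[h hX sh] := iP s.
pose Y := orbit_vectors sig (minimal_energy V).
(* [i] preserves distances, so approximants in the span of [X] pull back to S once they come from
   the span of [Y]. *)
suff : linear_span X `<=` i @` linear_span Y.
  by move=> /(_ _ hX)[s' Ys' s'h]; exists s'; rewrite // -(isom_dist _ _ ii) s'h.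
apply: span_sub; first split=> [|a _ _ [s1 Ys1 <-] [s2 Ys2 <-]].
- by exists 0; [exact: (span_subspace _).1 | rewrite (lin0 ii.1)].
- by exists (a *: s1 + s2); [exact: (span_subspace _).2 | rewrite ii.1].
move=> _ [g [v Uv ->]]; have [s' s'v] := iS _ (minE _ Uv).
exists (sig g s'); last by rewrite sigP s'v.
by apply: sub_span; exists g, s' => //; apply/Vmin; rewrite s'v.
Qed.

(* The ground-state coefficients <pi(g)v, w> determine everything; they are
   compared on the cyclic subrepresentations, where the unique extension
   property applies. *)
Lemma unique_extension_coeff : unique_extension_property alpha ->
  forall (H1 H2 : hilbertType R) (pi1 : G -> H1 -> H1) (U1 : R -> H1 -> H1)
    (pi2 : G -> H2 -> H2) (U2 : R -> H2 -> H2) (T0 : H1 -> H2),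
  positive_energy_rep alpha pi1 U1 -> positive_energy_rep alpha pi2 U2 ->
  unitary_on (minimal_energy U1) (minimal_energy U2) T0 ->
  intertwines (fix_action alpha) (minimal_energy U1) pi1 pi2 T0 ->
  forall g v w, minimal_energy U1 v -> minimal_energy U1 w ->
  hdot (pi1 g v) w = hdot (pi2 g (T0 v)) (T0 w).
Proof.
move=> Guniq H1 H2 pi1 U1 pi2 U2 T0 P1 P2 [T0l T0d T0s] T0i.
have [S1 [i1 [sig1 [V1 [i1i gs1 sig1E min1 lift1]]]]] := cyclic_subrep P1.
have [S2 [i2 [sig2 [V2 [i2i gs2 sig2E min2 lift2]]]]] := cyclic_subrep P2.
have T0min v : minimal_energy U1 v -> minimal_energy U2 (T0 v).
  by move=> v1; rewrite -T0s; exists v.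
(* [T0] transported to the cyclic subspaces, with the default 0 outside the minimal energy space. *)
have /choice[T T_] : forall s, exists s', minimal_energy V1 s -> i2 s' = T0 (i1 s).
  move=> s; have [/min1 /T0min /lift2[s' ->]|] := pselect (minimal_energy V1 s).
    by exists s'.
  by exists 0.
have Tmin s : minimal_energy V1 s -> minimal_energy V2 (T s).
  by move=> s1; apply/min2; rewrite T_ //; apply: T0min; apply/min1.
have Tu : unitary_on (minimal_energy V1) (minimal_energy V2) T.
  have [minsub _] := minimal_energy_subspace (per_group gs1.1).
  split=> [a s s' m m'|s s' m m'|].
  - apply: (isom_inj i2i); rewrite i2i.1 !T_ //; last exact: minsub.2.
    by rewrite i1i.1 T0l //; apply/min1.
  - by rewrite -i2i.2 !T_ // T0d ?i1i.2 //; apply/min1.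
  apply/seteqP; split=> [_ [s m <-]|s' /min2]; first exact: Tmin.
  rewrite -T0s => -[v v1 vs']; have [s vs] := lift1 _ v1.
  have ms : minimal_energy V1 s by apply/min1; rewrite -vs.
  by exists s => //; apply: (isom_inj i2i); rewrite T_ // -vs.
have Ti : intertwines (fix_action alpha) (minimal_energy V1) sig1 sig2 T.
  move=> g s gf m; apply: (isom_inj i2i).
  rewrite T_; last exact: (minimal_energy_fix gs1.1 gf m).
  by rewrite sig2E T_ // sig1E T0i //; apply/min1.
have [T' [/unitaryP[T'i _] T'int T'E]] := Guniq _ _ _ _ _ _ gs1 gs2 _ Tu Ti.
move=> g v w mv mw; have [s vs] := lift1 _ mv; have [s' ws'] := lift1 _ mw.
have ms : minimal_energy V1 s by apply/min1; rewrite -vs.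
have ms' : minimal_energy V1 s' by apply/min1; rewrite -ws'.
rewrite vs ws' -!T_ // -sig1E -sig2E i1i.2 i2i.2.
by rewrite -[LHS]T'i.2 T'int // !T'E.
Qed.

End CyclicSubrepresentation.

(** * Unique extension property of the direct limit *)

Section DirectLimit.
Variables (R : realType) (Gn : nat -> lieGroupType R).
Variables (iota : forall n, Gn n -> Gn n.+1).
Variables (G : topologicalGroupType) (j : forall n, Gn n -> G).
Arguments iota : clear implicits.
Arguments j : clear implicits.
Hypothesis G_limit : is_direct_limit iota j.
Variable alpha : R -> G -> G.
Variable alphan : forall n, R -> Gn n -> Gn n.
Arguments alphan : clear implicits.
Hypothesis alphan_restr : forall n t x, j n (alphan n t x) = alpha t (j n x).

Lemma dl_continuous n : continuous (j n).
Proof. by apply/continuousP => A /(dl_open G_limit)/(_ n). Qed.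

Lemma dl_continuousP (T : topologicalType) (f : G -> T) :
  (forall n, continuous (f \o j n)) -> continuous f.
Proof.
move=> fc; apply/continuousP => A Ao; apply/(dl_open G_limit) => n.
by have /continuousP := fc n; apply.
Qed.

Lemma fix_actionP n x : fix_action (alphan n) x <-> fix_action alpha (j n x).
Proof.
split=> xf t; first by rewrite -alphan_restr xf.
by apply: (dl_inj G_limit); rewrite alphan_restr xf.
Qed.

Lemma dl_restrict n (H : hilbertType R) (pi : G -> H -> H) (U : R -> H -> H) :
  positive_energy_rep alpha pi U ->
  positive_energy_rep (alphan n) (fun x => pi (j n x)) U.
Proof.
apply: restrict_positive_energy; first exact: (dl_hom G_limit).
  exact: dl_continuous.
exact: alphan_restr.
Qed.

Hypothesis Gn_unique : forall n, unique_extension_property (alphan n).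

(** Each coefficient is compared at a single level, where the restrictions need not be ground state
    representations. Totality enters only afterwards, in the Gram argument over the whole of G. *)
Lemma limit_unique_extension : unique_extension_property alpha.
Proof.
move=> H1 pi1 U1 H2 pi2 U2 [P1 tot1] [P2 tot2] T0 [T0l T0d T0s] T0i.
have coeff g v w : minimal_energy U1 v -> minimal_energy U1 w ->
    hdot (pi1 g v) w = hdot (pi2 g (T0 v)) (T0 w).
  have [n [x ->]] := dl_surj G_limit g.
  apply: (unique_extension_coeff (@Gn_unique n)
    (dl_restrict n P1) (dl_restrict n P2)) => //.
  by move=> y u /fix_actionP yf; exact: T0i.
pose I := {p : G * H1 | minimal_energy U1 p.2}.
pose a (p : I) := pi1 (sval p).1 (sval p).2.
pose b (p : I) := pi2 (sval p).1 (T0 (sval p).2).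
have aE : range a = orbit_vectors pi1 (minimal_energy U1).
  apply/seteqP; split=> [_ [[[g v] /= mv] _ <-]|_ [g [v mv ->]]].
    by exists g, v.
  by exists (exist _ (g, v) mv).
have bE : range b = orbit_vectors pi2 (minimal_energy U2).
  apply/seteqP; split=> [_ [[[g v] /= mv] _ <-]|_ [g [u + ->]]].
    by exists g, (T0 v) => //; rewrite -T0s; exists v.
  rewrite -T0s => -[v mv <-].
  by exists (exist _ (g, v) mv).
have ab p q : hdot (a p) (a q) = hdot (b p) (b q).
  case: p q => [[g v] /= mv] [[h w] /= mw]; rewrite /a /b /=.
  by rewrite (rep_dot_gram (per_rep P1)) (rep_dot_gram (per_rep P2)) coeff.
have ta : closure (linear_span (range a)) = setT by rewrite aE.
have tb : closure (linear_span (range b)) = setT by rewrite bE.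
have [T [Tu TE]] := gram_unitary ab ta tb.
have [Ti _] := (unitaryP T).1 Tu.
have T1 v : minimal_energy U1 v -> T v = T0 v.
  move=> mv; have := TE (exist _ (1%g, v) mv).
  by rewrite /a /b /= (rep1 (per_rep P1)) (rep1 (per_rep P2)).
exists T; split=> // g v _ _.
apply: (isom_eq_total (isom_comp (rep_isom (per_rep P1) g) Ti)
  (isom_comp Ti (rep_isom (per_rep P2) g)) tot1).
move=> w; rewrite inE => -[h [u mu ->]] /=.
have TE' k := TE (exist _ (k, u) mu); rewrite /a /b /= in TE'.
by rewrite -(repM (per_rep P1)) !TE' (repM (per_rep P2)).
Qed.

End DirectLimit.

(** * Bounded operators as combinations of unitaries *)

Section UnitaryCombinations.
Variables (R : realType) (H : hilbertType R).
Implicit Types (A B X Y : H -> H) (u : nat -> H).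

Lemma isom_cvg (K : hilbertType R) (A : H -> K) u l : isom A ->
  u @ \oo --> l -> (fun n => A (u n)) @ \oo --> A l.
Proof.
move=> Ai /cvg_nrmP ul; apply/cvg_nrmP => e /ul; apply: filterS => n.
by rewrite isom_dist.
Qed.

Lemma contraction_cvg A u l : linear A -> (forall v, nrm (A v) <= nrm v) ->
  u @ \oo --> l -> (fun n => A (u n)) @ \oo --> A l.
Proof.
move=> Al An /cvg_nrmP ul; apply/cvg_nrmP => e /ul; apply: filterS => n.
by apply: le_lt_trans; rewrite -(linB Al).
Qed.

Lemma hilbert_cvg_unique u (l l' : H) : u @ \oo --> l -> u @ \oo --> l' -> l = l'.
Proof. by move=> h h'; apply: (@cvg_unique _ _ (u @ \oo)). Qed.

Lemma rdot_cvg u l w : u @ \oo --> l -> (fun n => rdot (u n) w) @ \oo --> rdot l w.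
Proof.
move=> /cvg_nrmP ul; apply/cvgrPdist_lt => e e0.
have w0 : 0 < nrm w + 1 by rewrite ltr_wpDl // nrm_ge0.
have := ul _ (divr_gt0 e0 w0); apply: filterS => n.
rewrite ltr_pdivlMr // -rdotNl -rdotDl; apply: le_lt_trans.
apply: le_trans (rdot_norm_le _ _) _.
by rewrite ler_wpM2l ?nrm_ge0 // lerDl.
Qed.

Definition symm A := forall v w, rdot (A v) w = rdot v (A w).

Variables (A : H -> H).
Hypotheses (Al : linear A) (As : symm A) (An : forall v, nrm (A v) <= nrm v / 2).

(* Y = 1 - sqrt (1 - A^2) is the fixed point of Y |-> (A^2 + Y^2) / 2, which
   contracts the ball of radius 1/2. *)
Fixpoint sqrt_iter n (v : H) : H :=
  if n is n'.+1 then
    (2^-1 : R)%:C *: (A (A v) + sqrt_iter n' (sqrt_iter n' v))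
  else 0.

Local Notation Y := sqrt_iter.

Lemma sqrt_iter_linear n : linear (Y n).
Proof.
elim: n => [|n IH] a v w /=; first by rewrite scaler0 addr0.
rewrite !Al !IH scalerA mulrC -scalerA -scalerDr; congr (_ *: _).
by rewrite scalerDr addrACA.
Qed.

Lemma sqrt_iter_bound n v : nrm (Y n v) <= nrm v / 2.
Proof.
elim: n v => [|n IH] v /=; first by rewrite nrm0 divr_ge0 ?nrm_ge0.
rewrite nrmZr ger0_norm ?invr_ge0 //.
have := nrmD (A (A v)) (Y n (Y n v)).
have := An (A v); have := An v; have := IH (Y n v); have := IH v.
have := nrm_ge0 v; lra.
Qed.

Lemma sqrt_iter_symm n : symm (Y n).
Proof.
elim: n => [|n IH] v w /=; first by rewrite /rdot dot0l dot0r.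
by rewrite rdotZl rdotZr rdotDl rdotDr !As !IH.
Qed.

Lemma sqrt_iter_comm X n : linear X -> (forall v, A (X v) = X (A v)) ->
  forall v, Y n (X v) = X (Y n v).
Proof.
move=> Xl XA; elim: n => [|n IH] v /=; first by rewrite (lin0 Xl).
by rewrite (linZ Xl) (linD Xl) !XA !IH.
Qed.

(** With Y' the next iterate, Y'^2 - Y^2 = Y'(Y' - Y) + (Y' - Y)Y. Both iterates are bounded by 1/2,
    so each term contributes half of the previous bound, and the prefactor 1/2 remains. *)
Lemma sqrt_iter_step n v : nrm (Y n.+1 v - Y n v) <= 2^-1 ^+ n * nrm v.
Proof.
elim: n v => [|n IH] v.
  rewrite /= addr0 subr0 nrmZr ger0_norm ?invr_ge0 //.
  have := An (A v); have := An v; have := nrm_ge0 v; rewrite expr0; lra.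
have -> : Y n.+2 v - Y n.+1 v = (2^-1 : R)%:C *:
    (Y n.+1 (Y n.+1 v - Y n v) + (Y n.+1 (Y n v) - Y n (Y n v))).
  rewrite (linB (sqrt_iter_linear n.+1)) addrA subrK.
  transitivity ((2^-1 : R)%:C *: (A (A v) + Y n.+1 (Y n.+1 v)) -
                (2^-1 : R)%:C *: (A (A v) + Y n (Y n v))); first by [].
  by rewrite -scalerBr opprD addrACA subrr add0r.
rewrite nrmZr ger0_norm ?invr_ge0 // exprS.
have := nrmD (Y n.+1 (Y n.+1 v - Y n v)) (Y n.+1 (Y n v) - Y n (Y n v)).
have := sqrt_iter_bound n.+1 (Y n.+1 v - Y n v); have := IH v; have := IH (Y n v).
have := sqrt_iter_bound n v; have : 0 <= 2^-1 ^+ n :> R by rewrite exprn_ge0 ?invr_ge0.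
move: (_ ^+ n) => c; move: (nrm (Y n v)) (nrm v) => y z.
move: (nrm _) (nrm _) (nrm _) (nrm _) => *; nra.
Qed.

Lemma sqrt_iter_cvg : exists Z : H -> H, forall v, (Y n v : H) @[n --> \oo] --> (Z v : H).
Proof.
suff h v : exists l : H, Y n v @[n --> \oo] --> l.
  by have [Z ZP] := choice h; exists Z.
have tele m d : nrm (Y (m + d) v - Y m v) <= 2^-1 ^+ m * (2 * nrm v).
  (* The exact geometric sum, with its remainder kept so that the induction on d closes. *)
  suff : nrm (Y (m + d) v - Y m v) <= (2^-1 ^+ m - 2^-1 ^+ (m + d)) * (2 * nrm v).
    move=> /le_trans; apply; rewrite ler_wpM2r ?mulr_ge0 ?nrm_ge0 //.
    by rewrite gerBl exprn_ge0 ?invr_ge0.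
  elim: d => [|d IH]; first by rewrite addn0 !subrr nrm0 mul0r.
  apply: le_trans (nrm_tri _ (Y (m + d) v) _) _; rewrite addnS.
  have := sqrt_iter_step (m + d) v; rewrite exprS; move: IH; move: (_ ^+ _) (_ ^+ _).
  by move=> a b; move: (nrm _) (nrm _) (nrm _) => x y z; lra.
have [l lP] : exists l, forall e : R, 0 < e -> exists N, forall n, (N <= n)%N ->
     nrm (l - Y n v) < e.
  apply: nrm_complete => e e0.
  (* Two uses of [tele] from level N cost 4 |v| 2^-N; the 1 covers v = 0. *)
  have c0 : 0 < e / (4 * nrm v + 1).
    by rewrite divr_gt0 // ltr_wpDl // mulr_ge0 ?nrm_ge0.
  have : (2^-1 : R) ^+ n @[n --> \oo] --> (0 : R).
    by apply: cvg_expr; rewrite ger0_norm ?invr_ge0 // invf_lt1 // ltr1n.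
  move=> /cvgrPdist_lt/(_ _ c0)[N _ NP]; exists N => m n Nm Nn.
  have := NP N (leqnn N); rewrite /= sub0r normrN ger0_norm ?exprn_ge0 ?invr_ge0 //.
  rewrite ltr_pdivlMr ?ltr_wpDl ?mulr_ge0 ?nrm_ge0 //.
  have := tele N (m - N)%N; have := tele N (n - N)%N; rewrite !subnKC //.
  have := nrm_tri (Y m v) (Y N v) (Y n v); rewrite (nrmBC (Y N v)).
  have : 0 <= 2^-1 ^+ N :> R by rewrite exprn_ge0 ?invr_ge0.
  by have := nrm_ge0 v; move: (_ ^+ N) (nrm v) (nrm _) (nrm _) (nrm _) => *; nra.
exists l; apply/cvg_nrmP => e e0; have [N NP] := lP e e0.
by exists N => // n; apply: NP.
Qed.

(** The strong limit Z of the iterates solves 2Z = A^2 + Z^2, that is, A^2 + (1 - Z)^2 = 1. An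
    isometry commuting with A commutes with every iterate, hence with Z; this carries the commutant
    condition over to the unitaries. *)
Lemma sqrt_exists : exists Z : H -> H,
  [/\ linear Z, symm Z, forall v, A (A v) + Z (Z v) = Z v + Z v,
      forall v, A (Z v) = Z (A v)
    & forall X, isom X -> (forall v, A (X v) = X (A v)) ->
      forall v, Z (X v) = X (Z v)].
Proof.
have [Z ZP] := sqrt_iter_cvg.
have Al' v : nrm (A v) <= nrm v by apply: le_trans (An v) _; have := nrm_ge0 v; lra.
exists Z; split=> [a v w|v w|v|v|X Xi XA v].
- apply: hilbert_cvg_unique (ZP _) _.
  under eq_fun do rewrite sqrt_iter_linear.
  by apply: cvgD => //; apply: cvgZ => //; exact: cvg_cst.
- apply: (@cvg_unique _ _ (rdot (Y n v) w @[n --> \oo])) => //=.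
    exact: rdot_cvg.
  under eq_fun do rewrite sqrt_iter_symm rdotC.
  by rewrite rdotC; exact: rdot_cvg.
- suff ZE : Z v = (2^-1 : R)%:C *: (A (A v) + Z (Z v)).
    rewrite [in RHS]ZE -scalerDl -rmorphD /= (_ : 2^-1 + 2^-1 = 1 :> R) ?scale1r //.
    by field.
  have h : (Y n.+1 v : H) @[n --> \oo] --> (Z v : H).
    by have := ZP v; rewrite -cvg_shiftS.
  apply: hilbert_cvg_unique h _ => /=.
  apply: cvgZ; [exact: cvg_cst | apply: cvgD; [exact: cvg_cst|]].
  (* Operator and argument both vary in Y_n(Y_n v): the uniform bound on the iterates controls Y_n(Z
     v - Y_n v). *)
  apply/cvg_nrmP => e e0; have e2 : 0 < e / 2 by rewrite divr_gt0.
  have /cvg_nrmP/(_ _ e2) h1 := ZP v; have /cvg_nrmP/(_ _ e2) h2 := ZP (Z v).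
  near=> n; apply: le_lt_trans (nrm_tri _ (Y n (Z v)) _) _.
  have n1 : nrm (Z v - Y n v) < e / 2 by near: n.
  have n2 : nrm (Z (Z v) - Y n (Z v)) < e / 2 by near: n.
  rewrite -(linB (sqrt_iter_linear n)).
  have := sqrt_iter_bound n (Z v - Y n v); have := nrm_ge0 (Z v - Y n v); lra.
- apply: hilbert_cvg_unique (contraction_cvg Al Al' (ZP v)) _.
  have -> : (fun n => A (Y n v)) = (fun n => Y n (A v)).
    by apply/funext => n; rewrite (sqrt_iter_comm n Al).
  exact: ZP.
- apply: hilbert_cvg_unique (ZP _) _.
  under eq_fun do rewrite (sqrt_iter_comm _ Xi.1) //.
  exact: isom_cvg.
Unshelve. all: by end_near. Qed.

(** With P = 1 - Z, the symmetric operators A and P commute and satisfy A^2 + P^2 = 1, so A + iP and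
    A - iP are mutually inverse isometries with sum 2A. *)
Lemma symm_unitary_sum : exists W1 W2 : H -> H,
  [/\ unitary W1, unitary W2, forall v, W1 v + W2 v = A v + A v
    & forall X, isom X -> (forall v, A (X v) = X (A v)) ->
      (forall v, W1 (X v) = X (W1 v)) /\ (forall v, W2 (X v) = X (W2 v))].
Proof.
have [Z [Zl Zs ZE ZA Zc]] := sqrt_exists.
pose P v := v - Z v.
have Pl : linear P.
  by move=> a v w; rewrite /P Zl scalerBr opprD addrACA.
have Ps : symm P by move=> v w; rewrite /P rdotDl rdotDr rdotNl rdotNr Zs.
have PA v : A (P v) = P (A v) by rewrite /P (linB Al) ZA.
have APE v : A (A v) + P (P v) = v.
  have -> : A (A v) = Z v + Z v - Z (Z v) by rewrite -ZE addrK.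
  rewrite /P (linB Zl) opprB addrACA addKr [_ + _ + (v - _)]addrC.
  by rewrite addrA subrK addrK.
(* AP is symmetric and complex linear, so <v, APv> is real and Re<v, iAPv> vanishes. *)
have cross v : rdot (A v) ('i%C *: P v) = 0.
  have h1 : rdot (A v) ('i%C *: P v) = rdot v ('i%C *: P (A v)).
    by rewrite As (linZ Al) PA.
  have h2 : rdot v ('i%C *: P (A v)) = - rdot (A v) ('i%C *: P v).
    have <- : rdot ('i%C *: v) (P (A v)) = rdot (A v) ('i%C *: P v).
      by rewrite -Ps (linZ Pl) rdotC.
    by rewrite rdot_iN opprK.
  lra.
pose W (c : R[i]) v := A v + c *: P v.
have Wl c : linear (W c).
  move=> a v w; rewrite /W Al Pl (scalerDr c) addrACA (scalerDr a (A v)) !scalerA.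
  by rewrite (mulrC c).
have crossN v : rdot (A v) (- 'i%C *: P v) = 0 by rewrite scaleNr rdotNr cross oppr0.
have Wi (c : R[i]) : c = 'i%C \/ c = - 'i%C -> isom (W c).
  move=> cE; apply: nrm_isom => // v.
  apply/eqP; rewrite -(eqrXn2 (ltn0Sn 1)) ?nrm_ge0 // /W nrmD_sqr.
  have -> : rdot (A v) (c *: P v) = 0 by case: cE => ->.
  have -> : nrm (c *: P v) = nrm (P v).
    by case: cE => ->; rewrite ?scaleNr ?nrmN nrmi.
  by rewrite mulr0 addr0 -!rdot_nrm As Ps -rdotDr APE.
have WE (c : R[i]) v : c ^+ 2 = -1 -> W c (W (- c) v) = v.
  move=> c2; rewrite /W (linD Al) (linD Pl) (linZ Al) (linZ Pl) scalerDr scalerA.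
  rewrite mulrN -expr2 c2 opprK scale1r scaleNr PA addrACA.
  by rewrite addrA addrK APE.
have Wu (c : R[i]) : c = 'i%C \/ c = - 'i%C -> unitary (W c).
  move=> cE; apply/unitaryP; split=> [|w]; first exact: Wi.
  by exists (W (- c) w); apply: WE; case: cE => ->; rewrite ?sqrrN sqr_i.
have Wc c X : isom X -> (forall v, A (X v) = X (A v)) -> forall v, W c (X v) = X (W c v).
  by move=> Xi XA v; rewrite /W /P XA Zc // -(linB Xi.1) -(linZ Xi.1) -(linD Xi.1).
exists (W 'i%C), (W (- 'i%C)); split=> [||v|X Xi XA].
- by apply: Wu; left.
- by apply: Wu; right.
- by rewrite /W scaleNr addrACA subrr addr0.
- by split; apply: Wc.
Qed.

End UnitaryCombinations.

(* B = Re B + i Im B, and each self-adjoint part is, up to scaling, the sum of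
   the two unitaries A +- i sqrt (1 - A^2). *)
Lemma bounded_unitary_sum (R : realType) (H : hilbertType R) (B : H -> H) (M : R) :
  linear B -> (forall v, nrm (B v) <= M * nrm v) ->
  exists (c : 'I_4 -> R[i]) (W : 'I_4 -> H -> H),
  [/\ forall k, unitary (W k), forall v, B v = \sum_(k < 4) c k *: W k v
    & forall X X', isom X -> (forall v, X (X' v) = v) ->
      (forall v, B (X v) = X (B v)) -> forall k v, W k (X v) = X (W k v)].
Proof.
move=> Bl BM0; pose N : R := `|M| + 1; have N0 : 0 < N by rewrite ltr_wpDl.
have BM v : nrm (B v) <= N * nrm v.
  apply: le_trans (BM0 v) _; rewrite ler_wpM2r ?nrm_ge0 //.
  by apply: le_trans (ler_norm M) _; rewrite lerDl.
have [B' BB'] := adjoint_exists Bl BM.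
have B'l := adjoint_linear BB'; have B'M := adjoint_bound BB' (ltW N0) BM.
have rB v w : rdot (B v) w = rdot v (B' w) by rewrite /rdot BB'.
have rB' v w : rdot (B' v) w = rdot v (B w) by rewrite rdotC -rB rdotC.
(* [B] and its adjoint are bounded by [N], so their sum and difference are bounded by 2N; the factor
   [r] brings this to the 1/2 that [symm_unitary_sum] requires. *)
pose r := (4 * N)^-1; have r0 : 0 < r by rewrite invr_gt0 mulr_gt0.
have rN : r * (N + N) = 2^-1 by rewrite /r; field; rewrite gt_eqF.
pose A1 v := r%:C *: (B v + B' v).
pose A2 v := r%:C *: ('i%C *: (B' v - B v)).
have A1l : linear A1.
  move=> a v w; rewrite /A1 Bl B'l addrACA -(scalerDr a).
  by rewrite [LHS]scalerDr !scalerA mulrC.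
have A2l : linear A2.
  move=> a v w; rewrite /A2 Bl B'l opprD addrACA -scalerBr.
  move: (B' v - B v) (B' w - B w) => x y; rewrite !scalerDr !scalerA.
  by congr (_ *: _ + _); ring.
have A1s : symm A1.
  by move=> v w; rewrite rdotZl rdotZr rdotDl rdotDr rB rB' addrC.
have A2s : symm A2.
  move=> v w; rewrite rdotZl rdotZr; congr (_ * _).
  rewrite rdot_iN rdotDl rdotNl rB rB' (linZ Bl) (linZ B'l) opprB.
  by rewrite -rdotNr -rdotDr -scalerBr.
have A1n v : nrm (A1 v) <= nrm v / 2.
  rewrite nrmZr gtr0_norm // -rN [nrm v * _]mulrC -mulrA ler_wpM2l ?(ltW r0) //.
  by apply: le_trans (nrmD _ _) _; rewrite mulrDl lerD.
have A2n v : nrm (A2 v) <= nrm v / 2.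
  rewrite nrmZr nrmi gtr0_norm // -rN [nrm v * _]mulrC -mulrA ler_wpM2l ?(ltW r0) //.
  by apply: le_trans (nrmB _ _) _; rewrite mulrDl lerD.
have [W1 [W2 [W1u W2u W12 W12c]]] := symm_unitary_sum A1l A1s A1n.
have [W3 [W4 [W3u W4u W34 W34c]]] := symm_unitary_sum A2l A2s A2n.
have BE v : B v = N%:C *: (W1 v + W2 v) + (N%:C * 'i%C) *: (W3 v + W4 v).
  have h1 : N%:C * (r%:C + r%:C) = (2^-1 : R)%:C :> R[i].
    by rewrite -rmorphD -rmorphM /=; congr (_ %:C); rewrite -rN; ring.
  have h2 : N%:C * 'i%C * (r%:C + r%:C) * 'i%C = - (2^-1 : R)%:C :> R[i].
    by rewrite -mulrA mulrACA h1 -expr2 sqr_i mulrN1.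
  rewrite W12 W34 /A1 /A2 -!scalerDl !scalerA h1 h2 scaleNr -scalerBr opprB.
  rewrite addrACA subrr addr0 scalerDr -scalerDl -rmorphD /=.
  by rewrite (_ : 2^-1 + 2^-1 = 1 :> R) ?scale1r //; field.
pose c (k : 'I_4) : R[i] := if (k < 2)%N then N%:C else N%:C * 'i%C.
pose W (k : 'I_4) := nth id [:: W1; W2; W3; W4] k.
exists c, W; split=> [[[|[|[|[|//]]]]]|v|X X' Xi XX' XB] //.
  by rewrite BE !big_ord_recl big_ord0 /c /W /= addr0 !scalerDr -!addrA.
(* Passing to adjoints in BX = XB needs X unitary; its surjectivity comes from the right inverse
   [X']. *)
have XB' v : B' (X v) = X (B' v).
  apply: dot_ext => u; rewrite -{2}(XX' u) Xi.2 -!BB' -{1}(XX' u) XB Xi.2.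
  by [].
have [c1 c2] : (forall v, W1 (X v) = X (W1 v)) /\ (forall v, W2 (X v) = X (W2 v)).
  by apply: W12c => // v; rewrite /A1 XB XB' -(linD Xi.1) -(linZ Xi.1).
have [c3 c4] : (forall v, W3 (X v) = X (W3 v)) /\ (forall v, W4 (X v) = X (W4 v)).
  by apply: W34c => // v; rewrite /A2 XB XB' -(linB Xi.1) -!(linZ Xi.1).
by case=> [[|[|[|[|//]]]]] /=.
Qed.

(** * Strictness from the unique extension property *)

Section Strictness.
Variables (R : realType) (G : topologicalGroupType) (alpha : R -> G -> G).
Hypothesis alpha_hom : forall t, group_hom (alpha t).

Lemma fix_action_inv g : fix_action alpha g -> fix_action alpha g^-1%g.
Proof.
move=> gf t; have := alpha_hom t g g^-1%g.
rewrite mulgV (group_hom1 (alpha_hom t)) gf => /(congr1 (fun z => g^-1 * z)%g).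
by rewrite mulg1 mulgA mulVg mul1g.
Qed.

(** The property is applied to [pi] and itself. [B] is first transported to a Hilbert space S that
    is a copy of the minimal energy space, decomposed there into unitaries, and the extensions are
    recombined with the same coefficients. *)
Lemma unique_extension_strict (H : hilbertType R) (pi : G -> H -> H)
    (U : R -> H -> H) :
  unique_extension_property alpha -> ground_state_rep alpha pi U ->
  strict_ground_state_rep alpha pi U.
Proof.
move=> Guniq gs; split=> // B [Bl Bm [M BM]] Bi.
have P := gs.1; have Ug := per_group P.
have [msub mcl] := minimal_energy_subspace Ug.
have [S [i [ii iE]]] := closed_subspace_hilbert msub mcl.
have im s : minimal_energy U (i s) by rewrite -iE; exists s.
have mi v : minimal_energy U v -> exists s, i s = v by rewrite -iE => -[s _ <-]; exists s.
have iinj := isom_inj ii.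
have /choice[BS BSP] : forall s, exists s', i s' = B (i s).
  by move=> s; apply: mi; exact: Bm.
have /choice[rho rhoP] : forall g, exists f, fix_action alpha g ->
    forall s, i (f s) = pi g (i s).
  move=> g; have [gf|] := pselect (fix_action alpha g); last by exists id.
  suff /choice[f fP] : forall s, exists s', i s' = pi g (i s) by exists f.
  by move=> s; apply: mi; exact: (minimal_energy_fix P gf (im s)).
have BSl : linear BS.
  by move=> a v w; apply: iinj; rewrite BSP !ii.1 Bl // !BSP.
have BSM s : nrm (BS s) <= M * nrm s.
  rewrite -(isom_nrm _ ii) BSP -[nrm s](isom_nrm _ ii) -lecR rmorphM /= -!nrmE.
  exact: BM.
have [c [W [Wu BW Wc]]] := bounded_unitary_sum BSl BSM.
(* The right inverse of rho(g) asked for by [bounded_unitary_sum] is rho(g^-1); fixed points are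
   closed under inverses. *)
have Wrho k g s : fix_action alpha g -> W k (rho g s) = rho g (W k s).
  move=> gf; apply: (Wc _ (rho g^-1%g)) => [|s'|s'].
  - split=> [a v w|v w].
      by apply: iinj; rewrite rhoP // !ii.1 (rep_isom (per_rep P) g).1 !rhoP.
    by rewrite -ii.2 !rhoP // (rep_isom (per_rep P) g).2 ii.2.
  - apply: iinj; rewrite !rhoP //; last exact: fix_action_inv.
    by rewrite (repKV (per_rep P)).
  - by apply: iinj; rewrite BSP !rhoP // Bi // BSP.
have /choice[T TP] : forall k, exists T : H -> H,
    [/\ unitary T, intertwines setT setT pi pi T & forall s, T (i s) = i (W k s)].
  move=> k; have /choice[T0 T0P] : forall v, exists v', forall s,
      v = i s -> v' = i (W k s).
    move=> v; have [[s sv]|nv] := pselect (exists s, v = i s).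
      by exists (i (W k s)) => s'; rewrite sv => /iinj ->.
    by exists 0 => s sv; case: nv; exists s.
  have T0E s : T0 (i s) = i (W k s) by exact: T0P.
  have [Wi Ws] := (unitaryP _).1 (Wu k).
  have T0u : unitary_on (minimal_energy U) (minimal_energy U) T0.
    split=> [a v w|v w|].
    - move=> /mi[s <-] /mi[s' <-].
      by rewrite -ii.1 !T0E Wi.1 ii.1.
    - by move=> /mi[s <-] /mi[s' <-]; rewrite !T0E !ii.2 Wi.2.
    apply/seteqP; split=> [_ [v /mi[s <-] <-]|v /mi[s <-]].
      by rewrite T0E.
    by have [s' <-] := Ws s; exists (i s').
  have T0i : intertwines (fix_action alpha) (minimal_energy U) pi pi T0.
    by move=> g v gf /mi[s <-]; rewrite -rhoP // !T0E Wrho // rhoP.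
  have [T [Tu Ti TE]] := Guniq _ _ _ _ _ _ gs gs _ T0u T0i.
  by exists T; split=> // s; rewrite TE.
have Tisom k : isom (T k) by have [/unitaryP[]] := TP k.
exists (fun v => \sum_(k < 4) c k *: T k v); split.
- split=> // [a v w _ _|].
    rewrite scaler_sumr -big_split; apply: eq_bigr => k _ /=.
    by rewrite (Tisom k).1 scalerDr !scalerA mulrC.
  exists (\sum_(k < 4) complex.Re `|c k|) => v _.
  apply: le_trans (ler_norm_sum _ _ _) _.
  rewrite rmorph_sum mulr_suml; apply: ler_sum => k _ /=.
  by rewrite normrZ !nrmE isom_nrm // RRe_real ?normr_real.
- move=> g v _ _; rewrite (lin_sum (rep_isom (per_rep P) g).1).
  apply: eq_bigr => k _; have [_ Ti _] := TP k.
  by rewrite Ti // (linZ (rep_isom (per_rep P) g).1).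
- move=> _ /mi[s <-]; rewrite -BSP BW (lin_sum ii.1); apply: eq_bigr => k _.
  by have [_ _ ->] := TP k; rewrite (linZ ii.1).
Qed.

End Strictness.

(** * The ground state representation of the direct limit *)

Lemma continuous_slice (A B C : topologicalType) (f : A * B -> C) b :
  continuous f -> continuous (fun a => f (a, b)).
Proof.
move=> fc a; apply: (@continuous_comp _ _ _ (fun a => (a, b)) f); last exact: fc.
by apply: cvg_pair; [exact: cvg_id | exact: cvg_cst].
Qed.

(** In [R[i]], being nonnegative includes being real; so the real and the imaginary part are both
    passed to the limit. *)
Lemma dot_ge0_approx (R : realType) (H : hilbertType R) (v w : H) :
  (forall e : R, 0 < e -> exists2 w', nrm (w - w') < e & 0 <= hdot v w') ->
  0 <= hdot v w.
Proof.
move=> h; have bnd (e : R) : 0 < e -> exists w', [/\ 0 <= rdot v w',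
    rdot v ('i%C *: w') = 0, `|rdot v (w - w')| <= e & `|rdot v ('i%C *: (w - w'))| <= e].
  move=> e0; have v0 : 0 < nrm v + 1 by rewrite ltr_wpDl // nrm_ge0.
  have [w' ww'] := h _ (divr_gt0 e0 v0).
  rewrite dotE lecE /= => /andP[/eqP r1 r0]; exists w'.
  have le u : nrm u < e / (nrm v + 1) -> `|rdot v u| <= e.
    rewrite ltr_pdivlMr // => ue; apply: le_trans (rdot_norm_le _ _) _.
    by have := nrm_ge0 u; have := nrm_ge0 v; nra.
  by split=> //; apply: le; rewrite ?nrmi.
rewrite dotE lecE /=; apply/andP; split.
  rewrite -normr_eq0; apply/eqP/le_anti; rewrite normr_ge0 andbT.
  apply/ler_addgt0Pl => e /bnd[w' [_ r0 _]].
  by rewrite scalerBr rdotDr rdotNr r0 subr0 addr0.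
apply/ler_addgt0Pl => e /bnd[w' [r0 _ + _]].
by rewrite rdotDr rdotNr ler_norml => /andP[]; lra.
Qed.

Section LimitGroundState.
Variables (R : realType) (Gn : nat -> lieGroupType R).
Variables (iota : forall n, Gn n -> Gn n.+1).
Variables (G : topologicalGroupType) (j : forall n, Gn n -> G).
Arguments iota : clear implicits.
Arguments j : clear implicits.
Hypothesis G_limit : is_direct_limit iota j.
Variable alpha : R -> G -> G.
Hypothesis alpha_action : automorphic_action alpha.
Variable alphan : forall n, R -> Gn n -> Gn n.
Arguments alphan : clear implicits.
Hypothesis alphan_restr : forall n t x, j n (alphan n t x) = alpha t (j n x).
Hypothesis Gn_unique : forall n, unique_extension_property (alphan n).

Lemma iota_equivariant n t x : alphan n.+1 t (iota n x) = iota n (alphan n t x).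
Proof.
by apply: (dl_inj G_limit); rewrite alphan_restr !(dl_compat G_limit) alphan_restr.
Qed.

Lemma limit_ground_state (K : hilbertType R) (pi0 : G -> K -> K) :
  (forall n, extends_to_ground_state (alphan n) (fun x => pi0 (j n x))) ->
  extends_to_ground_state alpha pi0.
Proof.
move=> ext; have /choice[Hn HnP] := ext.
have /dep_choice[pin pinP] := HnP; have /dep_choice[Un UnP] := pinP.
have /dep_choice[Tn TnP] := fun n => (UnP n).2.
have gs n := (UnP n).1; have P n := (gs n).1.
have Tmin n v : minimal_energy (Un n) (Tn n v).
  by have [_ _ <-] := (TnP n).1; exists v.
have Tsurj n w : minimal_energy (Un n) w -> exists v, Tn n v = w.
  by have [_ _ <-] := (TnP n).1 => -[v _ <-]; exists v.
have Ti n : isom (Tn n).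
  by have [Tl Td _] := (TnP n).1; split=> [a v w|v w]; [apply: Tl | apply: Td].
have Tint n x v : fix_action (alphan n) x -> Tn n (pi0 (j n x) v) = pin n x (Tn n v).
  by move=> xf; apply: (TnP n).2.
pose a n (p : Gn n * K) := pin n p.1 (Tn n p.2).
have atot n : closure (linear_span (range (a n))) = setT.
  rewrite -[RHS](gs n).2; congr (closure (linear_span _)).
  apply/seteqP; split=> [_ [[x v] _ <-]|_ [x [_ /Tsurj[v <-] ->]]].
    by exists x, (Tn n v).
  by exists (x, v).
have Pup n : positive_energy_rep (alphan n) (fun x => pin n.+1 (iota n x)) (Un n.+1).
  apply: restrict_positive_energy (P n.+1).
  - exact: (dl_iota_hom G_limit).
  - exact: (dl_iota_smooth G_limit n).1.
  - by move=> t x; rewrite iota_equivariant.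
have coeff n x v w : hdot (pin n x (Tn n v)) (Tn n w) =
    hdot (pin n.+1 (iota n x) (Tn n.+1 v)) (Tn n.+1 w).
  (* [T0] is T_{n+1} after the inverse of T_n: the two minimal energy spaces are copies of the same
     K. The default 0 is taken elsewhere. *)
  have /choice[T0 T0P] : forall z, exists z', forall k, z = Tn n k -> z' = Tn n.+1 k.
    move=> z; have [[k zk]|nz] := pselect (exists k, z = Tn n k).
      by exists (Tn n.+1 k) => k'; rewrite zk => /(isom_inj (Ti n)) ->.
    by exists 0 => k zk; case: nz; exists k.
  have T0E k : T0 (Tn n k) = Tn n.+1 k by exact: T0P.
  rewrite -!T0E; apply: (unique_extension_coeff (@Gn_unique n) (P n) (Pup n)) => //.
    split=> [c _ _ /Tsurj[k <-] /Tsurj[k' <-]|_ _ /Tsurj[k <-] /Tsurj[k' <-]|].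
    - by rewrite -(Ti n).1 !T0E (Ti n.+1).1.
    - by rewrite !T0E (Ti n.+1).2 (Ti n).2.
    apply/seteqP; split=> [_ [_ /Tsurj[k <-] <-]|_ /Tsurj[k <-]].
      by rewrite T0E.
    by exists (Tn n k).
  move=> y _ yf /Tsurj[k <-]; rewrite -Tint // !T0E -(dl_compat G_limit) Tint //.
  by move=> t; rewrite iota_equivariant yf.
have /dep_choice[Phi PhiP] : forall n, exists F : Hn n -> Hn n.+1, isom F /\
    forall p, F (a n p) = pin n.+1 (iota n p.1) (Tn n.+1 p.2).
  move=> n; apply: gram_isom (atot n) => -[x v] [y w] /=.
  by rewrite (rep_dot_gram (per_rep (P n))) (rep_dot_gram (per_rep (Pup n))) coeff.
have [Hi [i [p [ii iPhi pi_adj approx]]]] := hilbert_direct_limit (fun n => (PhiP n).1).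
have up n x v N : (n <= N)%N -> exists2 y, j N y = j n x &
    i N (pin N y (Tn N v)) = i n (pin n x (Tn n v)).
  move=> nN; rewrite -(subnKC nN); elim: (N - n)%N => [|d [y yx iy]].
    by rewrite addn0; exists x.
  rewrite addnS; exists (iota _ y); first by rewrite (dl_compat G_limit).
  by rewrite -((PhiP _).2 (y, v)) iPhi.
(* e g v is to become pi(g)v; prescribing pi and U on these vectors makes the
   group laws and the covariance immediate. *)
have /choice[e eP] : forall g, exists f : K -> Hi,
    forall n x, j n x = g -> forall v, f v = i n (pin n x (Tn n v)).
  move=> g; have [m [y ->]] := dl_surj G_limit g.
  exists (fun v => i m (pin m y (Tn m v))) => n x xy v.
  have [z zy <-] := up m y v _ (leq_maxl m n).
  have [z' z'x <-] := up n x v _ (leq_maxr m n).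
  by rewrite (dl_inj G_limit (etrans zy (etrans (esym xy) (esym z'x)))).
have eE n x v : e (j n x) v = i n (pin n x (Tn n v)) by exact: eP.
have level g : exists n, forall N, (n <= N)%N -> exists x, j N x = g.
  have [n [x ->]] := dl_surj G_limit g; exists n => N /(up n x 0)[y yx _].
  by exists y.
have level3 g h k : exists n x y z, [/\ j n x = g, j n y = h & j n z = k].
  have [n1 l1] := level g; have [n2 l2] := level h; have [n3 l3] := level k.
  have [|x xg] := l1 (n1 + n2 + n3)%N; first by rewrite -addnA leq_addr.
  have [|y yh] := l2 (n1 + n2 + n3)%N; first by rewrite addnAC leq_addl.
  have [|z zk] := l3 (n1 + n2 + n3)%N; first by rewrite leq_addl.
  by exists (n1 + n2 + n3)%N, x, y, z.
pose ee (q : G * K) := e q.1 q.2.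
have etot : closure (linear_span (range ee)) = setT.
  pose E := closure (linear_span (range ee)).
  have Esub : subspace E by apply: closure_subspace; exact: span_subspace.
  have Ecl : closure E `<=` E by exact: closure_idem.
  have iE n y : E (i n y).
    have [Psub Pcl] := preim_subspace (ii n) Esub Ecl.
    suff : closure (linear_span (range (a n))) `<=` i n @^-1` E by rewrite atot; apply.
    apply: closure_span_sub Psub Pcl _ => _ [[x v] _ <-] /=.
    by apply: subset_closure; apply: sub_span; exists (j n x, v); rewrite // /ee /= eE.
  apply/seteqP; split=> // x _; apply: Ecl; apply/closure_nrmP => d d0.
  by have [N NP] := approx x d d0; exists (i N (p N x)); [exact: iE | exact: NP].
have /choice[pi piP] : forall g, exists A : Hi -> Hi,
    isom A /\ forall q, A (ee q) = e (g * q.1)%g q.2.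
  (* Left translation by g preserves the inner products of the vectors [e h v]: at a common level of
     all group elements involved it is the isometry pi_n(x). *)
  move=> g; apply: gram_isom etot => -[h v] [h' w]; rewrite /ee /=.
  have [n [x [y [z [<- <- <-]]]]] := level3 g h h'.
  rewrite -!(dl_hom G_limit) !eE !(repM (per_rep (P n))) !(ii n).2.
  by rewrite (rep_isom (per_rep (P n)) x).2.
have piE g h v : pi g (e h v) = e (g * h)%g v := (piP g).2 (h, v).
have pini n t x v : pin n (alphan n t x) (Tn n v) = Un n t (pin n x (Tn n v)).
  have /(minimal_energyP (per_group (P n))) h := Tmin n v.
  by rewrite -[in RHS](h (- t)) (per_covariant (P n)).
have /choice[U UP] : forall t, exists A : Hi -> Hi,
    isom A /\ forall q, A (ee q) = e (alpha t q.1) q.2.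
  move=> t; apply: gram_isom etot => -[h v] [h' w]; rewrite /ee /=.
  have [n [_ [y [z [_ <- <-]]]]] := level3 h h h'.
  rewrite -!alphan_restr !eE !pini !(ii n).2.
  by rewrite (ugroup_isom (per_group (P n)) t).2.
have UE t h v : U t (e h v) = e (alpha t h) v := (UP t).2 (h, v).
have eq_gen (A B : Hi -> Hi) : isom A -> isom B ->
    (forall h v, A (e h v) = B (e h v)) -> A =1 B.
  move=> Ai Bi AB; apply: (isom_eq_total Ai Bi etot) => _ /set_mem[[h v] _ <-].
  exact: AB.
(* In the direct limit topology continuity is tested on each G_n, where i_n is isometric and pi_n
   strongly continuous. *)
have econt v : continuous (fun g => e g v).
  apply: (dl_continuousP G_limit) => n.
  rewrite (_ : _ \o _ = (fun x => i n (pin n x (Tn n v)))); last first.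
    by apply/funext => x /=; rewrite eE.
  have /continuous_nrmP h := @rep_cont _ _ _ _ (per_rep (P n)) (Tn n v).
  apply/continuous_nrmP => x d d0; apply: filterS (h x d d0) => y.
  by rewrite (isom_dist _ _ (ii n)).
have piU : unitary_rep setT pi.
  apply: unitary_repP => [g|v|g h v|v].
  - exact: (piP g).1.
  - by apply: (eq_gen _ _ (piP 1%g).1 (isom_id Hi)) => h w; rewrite piE mul1g.
  - apply: (eq_gen _ _ (piP _).1 (isom_comp (piP h).1 (piP g).1)) => k w.
    by rewrite !piE mulgA.
  - apply: (isom_continuous_total (fun g => (piP g).1) etot) => _ /set_mem[[h w] _ <-].
    rewrite (_ : pi^~ _ = (fun g => e (g * h)%g w)); last first.
      by apply/funext => g; rewrite piE.
    have mc : continuous (fun g : G => (g * h)%g) :=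
      @continuous_slice _ _ _ _ h (@mulg_continuous G).
    by move=> g; exact: (@continuous_comp _ _ _ _ (fun g => e g w) g (mc g) (@econt w _)).
have UU : unitary_group U.
  apply: unitary_groupP => [t|v|s t v|v].
  - exact: (UP t).1.
  - apply: (eq_gen _ _ (UP 0).1 (isom_id Hi)) => h w.
    by rewrite UE (action0 alpha_action).
  - apply: (eq_gen _ _ (UP _).1 (isom_comp (UP t).1 (UP s).1)) => k w.
    by rewrite !UE (actionD alpha_action).
  - apply: (isom_continuous_total (fun t => (UP t).1) etot) => _ /set_mem[[h w] _ <-].
    rewrite (_ : U^~ _ = (fun t => e (alpha t h) w)); last first.
      by apply/funext => t; rewrite UE.
    have ac : continuous (fun t : R => alpha t h) :=
      @continuous_slice _ _ _ _ h (action_continuous alpha_action).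
    by move=> t; exact: (@continuous_comp _ _ _ _ (fun g => e g w) t (ac t) (@econt w _)).
have Ui n t y : U t (i n y) = i n (Un n t y).
  have Unt := ugroup_isom (per_group (P n)) t.
  apply: (isom_eq_total (isom_comp (ii n) (UP t).1) (isom_comp Unt (ii n)) (atot n)).
  by move=> _ /set_mem[[x v] _ <-]; rewrite -pini /a /= -!eE UE alphan_restr.
have dot_ip n v x : hdot (i n v) x = hdot v (p n x).
  by rewrite dotC -pi_adj -dotC.
(* p_n is the adjoint of i_n, so this is the adjoint of [Ui] at time - t. *)
have pU n t x : p n (U t x) = Un n t (p n x).
  apply: dot_ext => u; have := ugroupNK (per_group (P n)) (- t) u; rewrite opprK.
  move: (Un n (- t) u) => u' <-.
  by rewrite -dot_ip -Ui (UP t).1.2 dot_ip (ugroup_isom (per_group (P n)) t).2.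
have pl n : linear (p n) := adjoint_linear (dot_ip n).
have pn n x : nrm (p n x) <= nrm x.
  have in1 v : nrm (i n v) <= 1 * nrm v by rewrite mul1r isom_nrm.
  by have := adjoint_bound (dot_ip n) ler01 in1 x; rewrite mul1r.
have Upos : nonneg_hamiltonian U.
  (* <w, i_N p_N v> = <p_N w, p_N v> is nonnegative, as p_N carries the generator of [U] to that of
     U_N; and i_N p_N v tends to v. *)
  move=> v w vw; apply: dot_ge0_approx => d d0; have [N NP] := approx v d d0.
  exists (i N (p N v)); first exact: NP.
  rewrite -pi_adj; apply: (per_nonneg (P N)).
  by apply: hamiltonian_map vw; [exact: pl | exact: pn | exact: pU].
have Ucov t g v : U t (pi g (U (- t) v)) = pi (alpha t g) v.
  apply: (eq_gen _ _ (isom_comp (isom_comp (UP (- t)).1 (piP g).1) (UP t).1) (piP _).1).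
  move=> h w; rewrite !(UE, piE) (action_hom alpha_action).
  by rewrite -(actionD alpha_action) subrr (action0 alpha_action).
have e1 n v : e 1%g v = i n (Tn n v).
  by rewrite -(group_hom1 (dl_hom G_limit (n := n))) eE (rep1 (per_rep (P n))).
have emin v : minimal_energy U (e 1%g v).
  apply/(minimal_energyP UU) => t; rewrite (e1 0%N) Ui.
  by have /(minimal_energyP (per_group (P 0%N))) -> := Tmin 0%N v.
(* Every component of a fixed vector is fixed, hence of the form T_n k_n. Compatibility of the
   components forces k_n to be constant, and x is the limit of the corresponding vectors. *)
have mine x : minimal_energy U x -> exists v, e 1%g v = x.
  move=> /(minimal_energyP UU) xfix.
  have /choice[k kP] : forall n, exists v, Tn n v = p n x.
    move=> n; apply: Tsurj; apply/(minimal_energyP (per_group (P n))) => t.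
    by rewrite -pU xfix.
  have PhiT n v : Phi n (Tn n v) = Tn n.+1 v.
    apply: (isom_inj (ii n.+1)); rewrite iPhi.
    by rewrite -!e1.
  have kS n : k n.+1 = k n.
    apply: (isom_inj (Ti n)); rewrite kP; apply: dot_ext => u.
    by rewrite -dot_ip -iPhi dot_ip -kP -PhiT (PhiP n).1.2.
  have k0 n : k n = k 0%N by elim: n => // n <-.
  exists (k 0%N); apply: nrm_eps_eq => d d0; have [N NP] := approx x d d0.
  by rewrite nrmBC (e1 N) -(k0 N) kP; exact: NP.
exists Hi, pi, U; split.
  split=> //; apply/seteqP; split=> // x _.
  have : closure (linear_span (range ee)) x by rewrite etot.
  apply: closureS; apply: span_sub; first exact: span_subspace.
  move=> _ [[g v] _ <-]; apply: sub_span; exists g, (e 1%g v) => //.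
  by rewrite piE mulg1.
exists (e 1%g); split.
  split=> [c v w _ _|v w _ _|]; rewrite ?(e1 0%N).
  - by rewrite -(ii 0%N).1 -(Ti 0%N).1.
  - by rewrite (ii 0%N).2 (Ti 0%N).2.
  apply/seteqP; split=> [_ [v _ <-]|x /mine[v <-]]; first exact: emin.
  by exists v.
move=> g v gf _; rewrite piE mulg1; have [n [x gx]] := dl_surj G_limit g.
rewrite gx eE (e1 n) Tint //.
by apply/(fix_actionP G_limit alphan_restr); rewrite -gx.
Qed.

End LimitGroundState.

(** * Cones *)

Lemma restrict_fix_rep (R : realType) (G G' : topologicalGroupType)
    (S : set G) (S' : set G') (f : G' -> G) (H : hilbertType R) (pi : G -> H -> H) :
  group_hom f -> continuous f -> (forall x, S' x -> S (f x)) ->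
  unitary_rep S pi -> unitary_rep S' (fun x => pi (f x)).
Proof.
move=> fh fc fS [piu pim pic]; split=> [x /fS/piu//|x y v /fS xS /fS yS|v].
  by rewrite fh pim.
apply/subspace_continuousP => x S'x.
have /subspace_continuousP/(_ _ (fS _ S'x)) h := pic v.
move=> B /h hB; have hB' : nbhs (f x) [set y | S y -> B (pi y v)] := hB.
suff : nbhs x [set y | S' y -> B (pi (f y) v)] by [].
have h' : nbhs x (f @^-1` [set y | S y -> B (pi y v)]) := fc x _ hB'.
by apply: (filterS _ h') => y yB /fS; exact: yB.
Qed.

(** The row space of A is the image of x |-> xA. For an invariant complement W of it, WA lies in W
    and in the image, so it vanishes; hence W is contained in the kernel and equals it by
    dimension. *)
Lemma semisimple_ker_im (F : fieldType) (n : nat) (A : 'M[F]_n) :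
  semisimple_mx A ->
  (forall z : 'rV[F]_n, exists w y, w *m A = 0 /\ z = w + y *m A) /\
  (forall y : 'rV[F]_n, y *m A *m A = 0 -> y *m A = 0).
Proof.
move=> Ass; have [W [Wst VW cap]] := Ass A (submxMl A A).
have WA : W *m A = 0.
  apply/eqP; rewrite -submx0 -cap sub_capmx submxMl; exact: Wst.
split=> [z|y yAA].
  have : (z <= A + W)%MS by rewrite VW submx1.
  move=> /sub_addsmxP[[a b] /= zE]; exists (b *m W), a; split.
    by rewrite -mulmxA WA mulmx0.
  by rewrite addrC.
have kerE : (W == kermx A)%MS.
  have sub : (W <= kermx A)%MS by apply/sub_kermxP.
  rewrite -(mxrank_leqif_eq sub) mxrank_ker.
  have rk : (\rank A + \rank W = n)%N.
    by rewrite -mxrank_sum_cap VW cap mxrank1 mxrank0 addn0.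
  by rewrite -[X in (X - _)%N]rk addKn.
apply/eqP; rewrite -submx0 -cap sub_capmx submxMl /= (eqmxP kerE).
exact/sub_kermxP.
Qed.

Section Cones.
Variables (R : realType) (Gn : nat -> lieGroupType R).
Variables (iota : forall n, Gn n -> Gn n.+1).
Variables (G : topologicalGroupType) (j : forall n, Gn n -> G).
Arguments iota : clear implicits.
Arguments j : clear implicits.
Variables (L : topologicalLmodType R) (k : forall n, 'rV[R]_(mdim (Gn n)) -> L).
Arguments k : clear implicits.
Variables (br : L -> L -> L) (ex : L -> G).
Hypothesis L_limit : is_limit_lie_algebra iota j k br ex.
Variable Dn : forall n, 'M[R]_(mdim (Gn n)).
Hypothesis Dn_semisimple : forall n, semisimple_mx (Dn n).
Variable D : L -> L.
Hypothesis D_restr : forall n x, D (k n x) = k n (x *m Dn n).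

Lemma kD n x y : k n (x + y) = k n x + k n y.
Proof. by have := @dla_linear _ _ _ _ _ _ _ _ _ L_limit n 1 x y; rewrite !scale1r. Qed.

Lemma k0 n : k n 0 = 0.
Proof. by apply: (addIr (k n 0)); rewrite -kD !add0r. Qed.

Lemma kZ n a x : k n (a *: x) = a *: k n x.
Proof. by have := @dla_linear _ _ _ _ _ _ _ _ _ L_limit n a x 0; rewrite k0 !addr0. Qed.

Lemma kB n x y : k n (x - y) = k n x - k n y.
Proof. by rewrite -scaleN1r kD kZ scaleN1r. Qed.

Lemma dla_common_level (y z : L) : exists n u v, k n u = y /\ k n v = z.
Proof.
have level (t : L) : exists n, forall N, (n <= N)%N -> exists x, k N x = t.
  have [n [x ->]] := dla_surj L_limit t; exists n => N nN.
  rewrite -(subnKC nN); elim: (N - n)%N => [|d [u uE]].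
    by rewrite addn0; exists x.
  by rewrite addnS; exists (lie_map (iota _) u); rewrite (dla_compat L_limit).
have [n1 l1] := level y; have [n2 l2] := level z.
have [u uE] := l1 _ (leq_maxl n1 n2); have [v vE] := l2 _ (leq_maxr n1 n2).
by exists (maxn n1 n2), u, v.
Qed.

(** [D] is known only through its restrictions; additivity comes from placing both vectors at one
    level. *)
Lemma limit_derivationB y z : D (y - z) = D y - D z.
Proof.
have [n [u [v [<- <-]]]] := dla_common_level y z.
by rewrite -kB !D_restr -kB mulmxBl.
Qed.

Lemma limit_ker_im y : D (D y) = 0 -> D y = 0.
Proof.
have [n [u [_ [<- _]]]] := dla_common_level y 0.
rewrite !D_restr -(k0 n) => /(dla_inj L_limit) uDD.
by rewrite (semisimple_ker_im (@Dn_semisimple n)).2 // k0.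
Qed.

(** [proj_ker] is a choice, so uniqueness in L is the point: two candidates differ by an element of
    the kernel of [D] that is also in its image, and [limit_ker_im] makes it zero. *)
Lemma k_proj_ker n (z : 'rV[R]_(mdim (Gn n))) :
  k n (proj_ker (L := 'rV[R]_(mdim (Gn n))) (fun x => x *m Dn n) z) = proj_ker D (k n z).
Proof.
have [w [y [wD zE]]] := (semisimple_ker_im (@Dn_semisimple n)).1 z.
rewrite {1}/proj_ker; set Q := [set _ | _].
have [|pD [y' zE']] := xgetPex 0 (P := Q); first by exists w; split => //; exists y.
set p := xget _ _ in pD zE' *; apply/esym/xget_unique.
  split; first by rewrite D_restr pD k0.
  by exists (k n y'); rewrite D_restr -kD -zE'.
move=> u [Du [x kE]].
have uE : u - k n p = D (k n y' - x).
  rewrite limit_derivationB D_restr; apply/eqP.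
  by rewrite subr_eq addrAC eq_sym subr_eq -kD addrC -zE' kE addrC.
apply/eqP; rewrite -subr_eq0 uE limit_ker_im // -uE limit_derivationB Du.
by rewrite D_restr pD k0 subrr.
Qed.

Lemma k_continuous n : continuous (k n).
Proof. by apply/continuousP => A /(dla_open L_limit)/(_ n). Qed.

Lemma k_convex_hull n (A : set 'rV[R]_(mdim (Gn n))) x :
  convex_hull (L := 'rV[R]_(mdim (Gn n))) A x -> convex_hull (k n @` A) (k n x).
Proof.
move=> Ax B [Bc AB]; apply: (Ax (k n @^-1` B)); split.
  move=> y z l yB zB; rewrite inE /=.
  have := Bc (k n y) (k n z) l; rewrite !inE in yB zB *.
  move=> /(_ yB zB); congr (B _).
  by rewrite /conv /= -!kZ -kD.
by move=> y Ay; apply: AB; exists y.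
Qed.

(** k_n is linear and continuous and, by [k_proj_ker], takes the generators of the cone at level n
    to generators in L; convex hulls and closures follow. *)
Lemma k_cone_action n x : lie_cone_action (Dn n) x -> cone_action D br (k n x).
Proof.
rewrite /lie_cone_action /cone_action => xcl B /k_continuous /xcl[y [yA yB]].
exists (k n y); split=> //; move: (k_convex_hull yA) => h C [Cc hC]; apply: h.
split=> // _ [_ [z _ <-] <-]; apply: hC; exists (k n z) => //.
by rewrite D_restr (dla_bracket L_limit) k_proj_ker.
Qed.

Lemma restrict_cone n (K : hilbertType R) (pi0 : G -> K -> K) :
  cone_action D br `<=` cone_rep D ex pi0 ->
  lie_cone_action (Dn n) `<=` lie_cone_rep (Dn n) (fun x => pi0 (j n x)).
Proof.
move=> sub x /k_cone_action/sub[Dx pos]; split.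
  by apply: (dla_inj L_limit); rewrite -D_restr Dx k0.
rewrite (_ : (fun t => _) = (fun t => pi0 (ex (t *: k n x)))) //.
by apply/funext => t; rewrite -kZ (dla_exp L_limit).
Qed.

End Cones.

Theorem theorem8p2 (R : realType)
  (Gn : nat -> lieGroupType R) (iota : forall n, Gn n -> Gn n.+1)
  (G : topologicalGroupType) (j : forall n, Gn n -> G)
  (Gn_connected : forall n, connected [set: Gn n])
  (G_limit : is_direct_limit iota j)
  (L : topologicalLmodType R) (k : forall n, 'rV[R]_(mdim (Gn n)) -> L)
  (br : L -> L -> L) (ex : L -> G)
  (L_limit : is_limit_lie_algebra iota j k br ex)
  (alpha : R -> G -> G) (alpha_action : automorphic_action alpha)
  (alphan : forall n, R -> Gn n -> Gn n)
  (alphan_restr : forall n t x, j n (alphan n t x) = alpha t (j n x))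
  (Dn : forall n, 'M[R]_(mdim (Gn n)))
  (Dn_generator : forall n, is_generator (alphan n) (Dn n))
  (Dn_semisimple : forall n, semisimple_mx (Dn n))
  (D : L -> L) (D_restr : forall n x, D (k n x) = k n (x *m Dn n))
  (Gn_unique : forall n, unique_extension_property (alphan n))
  (Gn_sufficient : forall n (K : hilbertType R) (pi0 : Gn n -> K -> K),
     unitary_rep (fix_action (alphan n)) pi0 ->
     lie_cone_action (Dn n) `<=` lie_cone_rep (Dn n) pi0 ->
     extends_to_ground_state (alphan n) pi0)
  (K : hilbertType R) (pi0 : G -> K -> K)
  (pi0_rep : unitary_rep (fix_action alpha) pi0)
  (pi0_cone : cone_action D br `<=` cone_rep D ex pi0) :
  extends_uniquely_to_strict_ground_state alpha pi0.
Proof.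
have G_unique := limit_unique_extension G_limit alphan_restr Gn_unique.
split.
  have [|H [pi [U [gs pi0E]]]] :=
    limit_ground_state G_limit alpha_action alphan_restr Gn_unique (pi0 := pi0).
    move=> n; apply: Gn_sufficient.
      apply: restrict_fix_rep pi0_rep; first exact: (dl_hom G_limit).
        exact: (@dl_continuous _ _ _ _ _ G_limit n).
      by move=> x xf; apply/(fix_actionP G_limit alphan_restr).
    exact: (restrict_cone L_limit Dn_semisimple D_restr).
  exists H, pi, U; split=> //.
  exact: (unique_extension_strict (action_hom alpha_action) G_unique gs).
move=> H1 pi1 U1 H2 pi2 U2 [gs1 _] [T1 [[T1l T1d T1s] T1i]].
move=> [gs2 _] [T2 [[T2l T2d T2s] T2i]].
have T1i' : isom T1 by split=> [a v w|v w]; [apply: T1l | apply: T1d].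
have surj v : minimal_energy U1 v -> exists u, T1 u = v.
  by rewrite -T1s => -[u _ <-]; exists u.
(* [T0] is [T2] after the inverse of [T1], the resulting identification of the two minimal energy
   spaces through K. *)
have /choice[T0 T0P] : forall v, exists v', forall u, v = T1 u -> v' = T2 u.
  move=> v; have [[u vu]|nv] := pselect (exists u, v = T1 u).
    by exists (T2 u) => u'; rewrite vu => /(isom_inj T1i') ->.
  by exists 0 => u vu; case: nv; exists u.
have T0E u : T0 (T1 u) = T2 u by exact: T0P.
have [|g _ gf /surj[u <-]|T [Tu Ti _]] := G_unique _ _ _ _ _ _ gs1 gs2 T0.
- split=> [a _ _ /surj[u <-] /surj[u' <-]|_ _ /surj[u <-] /surj[u' <-]|].
  + by rewrite -T1l // !T0E T2l.
  + by rewrite !T0E T1d // T2d.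
  + rewrite -T2s; apply/seteqP; split=> [_ [_ /surj[u <-] <-]|_ [u _ <-]].
      by exists u; rewrite // T0E.
    by exists (T1 u); rewrite // -T1s; exists u.
- by rewrite -T1i // !T0E T2i.
by exists T.
Qed.
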